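(* Let $p$ be an odd prime and let $f\in\overline{\mathbb F}_p[x_1,x_2]$ be a polynomial such that $\Delta_f$ is a triangle with vertices $(0,0)$, $\mathbf P_1$, $\mathbf P_2$. Then the normalized Newton polygon $\mathrm{NP}(f,T)_C$ lies on or above $\mathrm{IHP}(\Delta_f)$.
   Context: For $f=\sum_{P\in\mathbb Z_{\ge0}^2} a_Px_1^{P_x}x_2^{P_y}$, $\Delta_f$ is the convex hull of $\{(0,0)\}\cup\{P:a_P\ne0\}$; $\hat f$ is its coefficientwise Teichmüller lift; $\mathbb F_q$, $q=p^n$, is the field generated over $\mathbb F_p$ by the coefficients of $f$; $\mathbb Q_{q^k}$ is the unramified extension of $\mathbb Q_p$ with residue field $\mathbb F_{q^k}$, and $\hat x$ denotes the Teichmüller lift of $x$. $T$-adic characteristic series: $S_f^*(k,T)=\sum_{(x_1,x_2)\in(\mathbb F_{q^k}^\times)^2}(1+T)^{\mathrm{Tr}_{\mathbb Q_{q^k}/\mathbb Q_p}(\hat f(\hat x_1,\hat x_2))}$ and $$C_f^*(T,s)=\exp\Big(\sum_{k\ge1}-(q^k-1)^{-2}S_f^*(k,T)\frac{s^k}{k}\Big)=\sum_{i\ge0}u_i(T)s^i\in\mathbb Z_p[[T,s]].$$ $\mathrm{NP}(f,T)_C$ is the lower convex hull of the points $\big(i,\frac{v_T(u_i)}n\big)$, where $v_T$ is the $T$-adic valuation on $\mathbb Z_p[[T]]$. Improved Hodge polygon of $\Delta=\Delta_f$: $\mathbb M(\Delta)$ is the set of lattice points in the cone $\{P\in\mathbb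 R^2:kP\in\Delta\text{ for some }k>0\}$, and $w$ is the linear function on $\mathbb R^2$ equal to $1$ on the line through $\mathbf P_1$ and $\mathbf P_2$. For a finite multiset $S$ of points of $\mathbb M(\Delta)$, $h(S)=\min_\tau\sum_{P\in S}\lceil w(p\tau(P)-P)\rceil$ over all permutations $\tau$ of $S$ (as a multiset). $\mathrm{IHP}(\Delta)$ is the lower convex hull of the points $\big(\ell,\frac1n\min_Sh(S)\big)$, $\ell\ge0$, where $S$ runs over all sub-multisets of cardinality $n\ell$ of the union of $n$ copies of $\mathbb M(\Delta)$. *)

(* Defs.v *)
From HB Require Import structures.
From mathcomp Require Import all_boot all_order all_fingroup all_algebra all_field.
From mathcomp Require Import finmap multiset.
From mathcomp Require Import boolp classical_sets functions cardinality fsbigop.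
From mathcomp Require Import reals ereal convex.
(* The notations of multinomials clash with those of mathcomp-analysis; only
   the constants and canonical structures of mpoly are imported. *)
From mathcomp Require Import -(notations) mpoly.

Set Implicit Arguments.
Unset Strict Implicit.
Unset Printing Implicit Defensive.
Import Order.TTheory GRing.Theory Num.Theory.

Local Open Scope classical_set_scope.
Local Open Scope ring_scope.

(* An element of lim_m Z/p^m is stored as its sequence of representatives in
   [0, p^m); the compatibility condition forces the representatives to be
   reduced.  The primality proof is a parameter so that the type is canonically
   an integral domain. *)
Record padic_int (p : nat) (p_pr : prime p) := PadicInt {
  padic_rep : nat -> int;
  padic_repP : forall m, (padic_rep m.+1 %% (p ^ m)%:Z)%Z = padic_rep m
}.

HB.instance Definition _ p (p_pr : prime p) := gen_eqMixin (padic_int p_pr).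
HB.instance Definition _ p (p_pr : prime p) := gen_choiceMixin (padic_int p_pr).

Section PadicInt.
Variables (p : nat) (p_pr : prime p).
Local Notation Zp := (padic_int p_pr).
Implicit Types a b c : Zp.
Local Notation P m := ((p ^ m)%N%:Z).

Lemma padic_eq a b : (forall m, padic_rep a m = padic_rep b m) -> a = b.
Proof.
case: a b => [a aP] [b bP] /= /funext eq_ab.
by subst b; congr PadicInt; apply: Prop_irrelevance.
Qed.

Lemma padic_rep_mod a m : (padic_rep a m %% P m)%Z = padic_rep a m.
Proof. by rewrite -padic_repP modz_mod. Qed.

Lemma modz_dvdm d e x : (d %| e)%Z -> ((x %% e)%Z = x %[mod d])%Z.
Proof.
by case/dvdzP=> q ->; rewrite [in RHS](divz_eq x (q * d)) mulrA modzMDl.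
Qed.

Lemma padic_modS x m : ((x %% P m.+1)%Z %% P m)%Z = (x %% P m)%Z.
Proof. by rewrite modz_dvdm // expnS PoszM dvdz_mull. Qed.

Lemma padic_rep_le a m n : (m <= n)%N ->
  (padic_rep a n %% P m)%Z = padic_rep a m.
Proof.
move=> /subnK <-; elim: (n - m)%N => [|k IHk]; first exact: padic_rep_mod.
rewrite addSn -[RHS]IHk -[in RHS]padic_repP modz_dvdm //.
by rewrite addnC expnD PoszM dvdz_mulr.
Qed.

(* The class of a compatible (not necessarily reduced) sequence. *)
Definition padic_of (f : nat -> int)
    (fP : forall m, (f m.+1 %% P m)%Z = (f m %% P m)%Z) : Zp.
Proof.
by exists (fun m => (f m %% P m)%Z) => m; rewrite padic_modS.
Defined.

Fact padic_int_subproof (z : int) m :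
  ((fun=> z) m.+1 %% P m)%Z = ((fun _ : nat => z) m %% P m)%Z.
Proof. by []. Qed.

Fact padic_add_subproof a b m :
  ((fun m => padic_rep a m + padic_rep b m) m.+1 %% P m)%Z =
  ((fun m => padic_rep a m + padic_rep b m) m %% P m)%Z.
Proof. by rewrite /= -modzDm !padic_repP. Qed.

Fact padic_opp_subproof a m :
  ((fun m => - padic_rep a m) m.+1 %% P m)%Z =
  ((fun m => - padic_rep a m) m %% P m)%Z.
Proof. by rewrite /= -modzNm padic_repP. Qed.

Fact padic_mul_subproof a b m :
  ((fun m => padic_rep a m * padic_rep b m) m.+1 %% P m)%Z =
  ((fun m => padic_rep a m * padic_rep b m) m %% P m)%Z.
Proof. by rewrite /= -modzMm !padic_repP. Qed.

Definition padic_const z : Zp := padic_of (padic_int_subproof z).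
Definition padic_add a b : Zp := padic_of (padic_add_subproof a b).
Definition padic_opp a : Zp := padic_of (padic_opp_subproof a).
Definition padic_mul a b : Zp := padic_of (padic_mul_subproof a b).

Fact padic_addA : associative padic_add.
Proof. by move=> a b c; apply: padic_eq => m /=; rewrite modzDmr modzDml addrA. Qed.
Fact padic_addC : commutative padic_add.
Proof. by move=> a b; apply: padic_eq => m /=; rewrite addrC. Qed.
Fact padic_add0 : left_id (padic_const 0) padic_add.
Proof. by move=> a; apply: padic_eq => m /=; rewrite modzDml add0r padic_rep_mod. Qed.
Fact padic_addN : left_inverse (padic_const 0) padic_opp padic_add.
Proof. by move=> a; apply: padic_eq => m /=; rewrite modzDml addNr. Qed.

HB.instance Definition _ := GRing.isZmodule.Build Zp
  padic_addA padic_addC padic_add0 padic_addN.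

Fact padic_mulA : associative padic_mul.
Proof. by move=> a b c; apply: padic_eq => m /=; rewrite modzMmr modzMml mulrA. Qed.
Fact padic_mulC : commutative padic_mul.
Proof. by move=> a b; apply: padic_eq => m /=; rewrite mulrC. Qed.
Fact padic_mul1 : left_id (padic_const 1) padic_mul.
Proof. by move=> a; apply: padic_eq => m /=; rewrite modzMml mul1r padic_rep_mod. Qed.
Fact padic_mulD : left_distributive padic_mul padic_add.
Proof.
by move=> a b c; apply: padic_eq => m /=; rewrite modzMml modzDm mulrDl.
Qed.
Fact padic_1neq0 : padic_const 1 != padic_const 0.
Proof.
apply/eqP => /(congr1 (fun a => padic_rep a 1)) /=; rewrite expn1 mod0z modz_small //.
by rewrite ler01 ltz_nat prime_gt1.
Qed.

HB.instance Definition _ := GRing.Zmodule_isComNzRing.Build Zp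
  padic_mulA padic_mulC padic_mul1 padic_mulD padic_1neq0.

Definition padic_unit : pred Zp := fun a => `[< exists b, b * a = 1 >].
Definition padic_inv a : Zp :=
  if padic_unit a then xget 0 [set b | b * a = 1] else a.

Fact padic_mulV : {in padic_unit, left_inverse 1 padic_inv *%R}.
Proof.
move=> a a_unit; rewrite /padic_inv ifT //.
have /asboolP[b ba1] : padic_unit a := a_unit.
by case: xgetP => [c _ //|/(_ b)]; rewrite /= ba1.
Qed.
Fact padic_unitP a b : b * a = 1 -> padic_unit a.
Proof. by move=> ba1; apply/asboolP; exists b. Qed.
Fact padic_invr_out : {in [predC padic_unit], padic_inv =1 id}.
Proof. by move=> a /negbTE an; rewrite /padic_inv ifF //; exact: an. Qed.

HB.instance Definition _ := GRing.ComNzRing_hasMulInverse.Build Zp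
  padic_mulV padic_unitP padic_invr_out.

Fact padic_neq0 a : a != 0 -> exists i, padic_rep a i != 0.
Proof.
apply: contra_neqP => /forallNP a0; apply: padic_eq => m /=.
by rewrite mod0z; apply/eqP/negPn/negP/a0.
Qed.

Fact padic_ndvd a i m : padic_rep a i != 0 -> (i <= m)%N ->
  ~~ (P i %| padic_rep a m)%Z.
Proof. by move=> ai0 im; rewrite dvdzE; apply: contra ai0 => /dvdz_mod0P; rewrite padic_rep_le // => ->. Qed.

Fact padic_idomain : GRing.integral_domain_axiom Zp.
Proof.
move=> a b ab0; apply: contraPT (congr1 (@padic_rep _ _) ab0).
rewrite negb_or => /andP[/padic_neq0[i ai] /padic_neq0[j bj]].
move=> /(congr1 (@^~ (i + j)%N)) /= /eqP; rewrite mod0z => /eqP/dvdz_mod0P.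
have := padic_ndvd ai (leq_addr j i); have := padic_ndvd bj (leq_addl i j).
rewrite !dvdzE !abszM !absz_nat.
set x := `|_|%N; set y := `|_|%N => xj yi.
have x0 : (0 < x)%N by case: x xj => //; rewrite dvdn0.
have y0 : (0 < y)%N by case: y yi => //; rewrite dvdn0.
rewrite !pfactor_dvdn ?muln_gt0 ?x0 ?y0 // in xj yi *.
rewrite lognM //; move: xj yi; rewrite -!ltnNge => xj yi.
by rewrite leqNgt -addSn leq_add // ltnW.
Qed.

HB.instance Definition _ := GRing.ComUnitRing_isIntegral.Build Zp padic_idomain.

End PadicInt.

Definition padic (p : nat) (p_pr : prime p) := {fraction (padic_int p_pr)}.

Record fps (R : Type) := Fps { fcoef : nat -> R }.

HB.instance Definition _ (R : Type) := gen_eqMixin (fps R).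
HB.instance Definition _ (R : Type) := gen_choiceMixin (fps R).

Section FpsRing.
Variable R : comNzRingType.
Implicit Types f g h : fps R.

Lemma fps_eq f g : (forall i, fcoef f i = fcoef g i) -> f = g.
Proof. by case: f g => [f] [g] /= /funext ->. Qed.

Definition fps_zero : fps R := Fps (fun=> 0).
Definition fps_opp f : fps R := Fps (fun i => - fcoef f i).
Definition fps_add f g : fps R := Fps (fun i => fcoef f i + fcoef g i).
Definition fps_one : fps R := Fps (fun i => (i == 0)%N%:R).
Definition fps_mul f g : fps R :=
  Fps (fun i => \sum_(j < i.+1) fcoef f j * fcoef g (i - j)).
Definition fps_scale (c : R) f : fps R := Fps (fun i => c * fcoef f i).

Fact fps_addA : associative fps_add.
Proof. by move=> f g h; apply: fps_eq => i; apply: addrA. Qed.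
Fact fps_addC : commutative fps_add.
Proof. by move=> f g; apply: fps_eq => i; apply: addrC. Qed.
Fact fps_add0 : left_id fps_zero fps_add.
Proof. by move=> f; apply: fps_eq => i; apply: add0r. Qed.
Fact fps_addN : left_inverse fps_zero fps_opp fps_add.
Proof. by move=> f; apply: fps_eq => i; apply: addNr. Qed.

HB.instance Definition _ :=
  GRing.isZmodule.Build (fps R) fps_addA fps_addC fps_add0 fps_addN.

Definition fps_trunc n f : {poly R} := \poly_(i < n) fcoef f i.

Fact fps_mul_trunc n f g i : (i < n)%N ->
  fcoef (fps_mul f g) i = (fps_trunc n f * fps_trunc n g)`_i.
Proof.
move=> lt_in; rewrite coefM; apply: eq_bigr => j _; rewrite !coef_poly.
rewrite (leq_ltn_trans (leq_subr _ _) lt_in).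
by rewrite (leq_trans (ltn_ord j)).
Qed.

Fact fps_mulC : commutative fps_mul.
Proof.
by move=> f g; apply: fps_eq => i; rewrite !(@fps_mul_trunc i.+1) // mulrC.
Qed.

Fact fps_mulA : associative fps_mul.
Proof.
move=> f g h; apply: fps_eq => i; rewrite !(@fps_mul_trunc i.+1) //.
have coef_truncM u v (w : {poly R}) :
    (w * fps_trunc i.+1 (fps_mul u v))`_i =
    (w * (fps_trunc i.+1 u * fps_trunc i.+1 v))`_i.
  rewrite !coefM; apply: eq_bigr => j _; congr (_ * _).
  by rewrite coef_poly ltnS leq_subr (@fps_mul_trunc i.+1) // ltnS leq_subr.
by rewrite coef_truncM mulrA [in RHS]mulrC coef_truncM [in RHS]mulrC.
Qed.

Fact fps_mul1 : left_id fps_one fps_mul.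
Proof.
move=> f; apply: fps_eq => i /=; rewrite big_ord_recl /= mul1r subn0.
by rewrite big1 ?addr0 // => j _; rewrite mul0r.
Qed.

Fact fps_mulD : left_distributive fps_mul fps_add.
Proof.
move=> f g h; apply: fps_eq => i /=; rewrite -big_split /=.
by apply: eq_bigr => j _; rewrite mulrDl.
Qed.

Fact fps_1neq0 : fps_one != fps_zero.
Proof.
by apply/eqP => /(congr1 (fun f => fcoef f 0)) /= /eqP; rewrite oner_eq0.
Qed.

HB.instance Definition _ := GRing.Zmodule_isComNzRing.Build (fps R)
  fps_mulA fps_mulC fps_mul1 fps_mulD fps_1neq0.

Fact fps_scaleA a b f : fps_scale a (fps_scale b f) = fps_scale (a * b) f.
Proof. by apply: fps_eq => i; apply: mulrA. Qed.
Fact fps_scale1 : left_id 1 fps_scale.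
Proof. by move=> f; apply: fps_eq => i; apply: mul1r. Qed.
Fact fps_scaleDr : right_distributive fps_scale +%R.
Proof. by move=> c f g; apply: fps_eq => i; apply: mulrDr. Qed.
Fact fps_scaleDl f : {morph fps_scale^~ f : a b / a + b}.
Proof. by move=> a b; apply: fps_eq => i; apply: mulrDl. Qed.

HB.instance Definition _ := GRing.Zmodule_isLmodule.Build R (fps R)
  fps_scaleA fps_scale1 fps_scaleDr fps_scaleDl.

Fact fps_scaleAl (a : R) f g : a *: (f * g) = a *: f * g.
Proof.
apply: fps_eq => i /=; rewrite mulr_sumr.
by apply: eq_bigr => j _; rewrite mulrA.
Qed.

HB.instance Definition _ := GRing.Lmodule_isLalgebra.Build R (fps R) fps_scaleAl.
HB.instance Definition _ := GRing.Lalgebra_isComAlgebra.Build R (fps R).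

End FpsRing.

(* Meaningful when the constant coefficient of g is 0: the terms g ^+ m / m!
   with m > i then do not contribute to the coefficient of s^i. *)
Definition fps_exp (F : fieldType) (A : comAlgType F) (g : fps A) : fps A :=
  Fps (fun i => \sum_(m < i.+1) (m`!%:R^-1 : F) *: fcoef (g ^+ m) i).

(* The binomial series (1 + T)^a = sum_j binom(a, j) T^j. *)
Definition fps_binom (F : fieldType) (a : F) : fps F :=
  Fps (fun j => (\prod_(i < j) (a - i%:R)) / j`!%:R).

(* T-adic valuation, with value +oo at 0. *)
Definition fps_val (R : realType) (F : comNzRingType) (u : fps F) : \bar R :=
  ereal_inf [set j%:R%:E | j in [set j : nat | fcoef u j != 0]].

Section Unramified.
Variables (p : nat) (p_pr : prime p).
Variables (K : fieldType).

Definition ring_of_integers (L : fieldExtType (padic p_pr)) : set L :=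
  [set x : L | integralOver (in_alg L \o @tofrac (padic_int p_pr)) x].
Arguments ring_of_integers : clear implicits.

(* The subfield with Q elements of an algebraic closure of F_p, for Q a power
   of p with positive exponent. *)
Definition finite_subfield (Q : nat) : set K := [set x | x ^+ Q = x].

(* A finite extension of Q_p in which p generates the maximal ideal of the ring
   of integers and whose residue field is identified with the subfield of K
   with Q elements.  The values of ur_red are relevant on integers only.  Two such
   identifications differ by a Frobenius, which lifts to an automorphism of the
   extension, so traces of Teichmueller lifts do not depend on the choice. *)
Record unramified_ext (Q : nat) := UnramifiedExt {
  ur_field :> fieldExtType (padic p_pr);
  ur_red : ur_field -> K;
  ur_red1 : ur_red 1 = 1;
  ur_redD : {in ring_of_integers ur_field &, {morph ur_red : x y / x + y}};
  ur_redM : {in ring_of_integers ur_field &, {morph ur_red : x y / x * y}};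
  ur_red_img : ur_red @` ring_of_integers ur_field = finite_subfield Q;
  ur_red_ker : forall x, ring_of_integers ur_field x ->
    ur_red x = 0 <-> exists2 y, ring_of_integers ur_field y & x = p%:R * y
}.

(* The root of Y^Q = Y reducing to x, unique by Hensel's lemma when x lies in the
   residue field. *)
Definition teichmuller (Q : nat) (L : unramified_ext Q) (x : K) : L :=
  xget 0 [set y : L | [/\ ring_of_integers L y, ur_red y = x & y ^+ Q = y]].

Definition field_trace (F : fieldType) (L : fieldExtType F) (x : L) : F :=
  \sum_i coord (vbasis {:L}) i (x * (vbasis {:L})`_i).

Definition lift_value (Q : nat) (L : unramified_ext Q) (f : mpoly 2 K)
    (x : K * K) : L :=
  meval (fun i : 'I_2 => teichmuller L (if i == ord0 then x.1 else x.2))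
        (map_mpoly (teichmuller L) f).

Definition finite_units (Q : nat) : set K := finite_subfield Q `\ 0.

Definition exp_sum (Q : nat) (L : unramified_ext Q) (f : mpoly 2 K) :
    fps (padic p_pr) :=
  \sum_(x \in finite_units Q `*` finite_units Q)
    fps_binom (field_trace (lift_value L f x)).

(* L k is the unramified extension with residue field of cardinality q^(k+1);
   the exponent 0 is excluded since it does not define a finite subfield. *)
Definition char_series (q : nat)
    (L : forall k : nat, unramified_ext (q ^ k.+1)) (f : mpoly 2 K) :
    fps (fps (padic p_pr)) :=
  fps_exp (Fps (fun k => if k is k'.+1 then
      - (((q ^ k)%:R - 1) ^- 2 / k%:R : padic p_pr) *: exp_sum (L k') f
    else 0)).

Definition coeff_field (f : mpoly 2 K) : set K :=
  smallest [set A : set K | divring_closed [in A]] [set mcoeff m f | m in setT].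

End Unramified.

Section Polygons.
Variable R : realType.

Notation plane := (R^o * R^o)%type.

Definition convex_hull (A : set plane) : set plane :=
  smallest (@convex_set R plane) A.

(* The lower boundary of the convex hull of the points (i, y i); the points
   with y i = +oo are disregarded, and the value is +oo off the projection of
   the hull. *)
Definition lower_hull (y : nat -> \bar R) (x : R) : \bar R :=
  ereal_inf [set z%:E | z in [set z |
    convex_hull [set P : plane | exists2 i : nat, P.1 = i%:R & P.2%:E = y i] (x, z)]].

Definition newton_polytope (K : fieldType) (f : mpoly 2 K) : set plane :=
  convex_hull ((0, 0) |`
    [set ((m ord0)%:R, (m ord_max)%:R) | m in [set m | mcoeff m f != 0]]).

Definition lattice_pt (P : int * int) : plane := (P.1%:~R, P.2%:~R).

Definition cone_lattice (D : set plane) : set (int * int) :=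
  [set P | exists2 k : R, 0 < k & D (k *: lattice_pt P)].

(* The permutations of the multiset S are the permutations of the positions of
   an enumeration of S. *)
Definition perm_cost (p : nat) (w : {scalar plane}) (S : {mset int * int}%mset)
    (t : 'S_(size S)) : int :=
  \sum_i Num.ceil (w (p%:R *: lattice_pt (tnth (in_tuple S) (t i))
                      - lattice_pt (tnth (in_tuple S) i))).

Definition min_cost (p : nat) (w : {scalar plane}) (S : {mset int * int}%mset) : int :=
  \big[Order.min/@perm_cost p w S 1%g]_(t : 'S_(size S)) @perm_cost p w S t.

Definition ihp (p n : nat) (D : set plane) (w : {scalar plane}) : R -> \bar R :=
  lower_hull (fun l => (n%:R^-1)%:E *
    ereal_inf [set (min_cost p w S)%:~R%:E | S in [set S : {mset int * int}%mset |
      [/\ size S = (n * l)%N, (forall P, P \in S -> cone_lattice D P)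
        & forall P, (S P <= n)%N]]])%E.

Definition np_T (p : nat) (p_pr : prime p) (n : nat) (C : fps (fps (padic p_pr))) :
    R -> \bar R :=
  lower_hull (fun i => (n%:R^-1)%:E * fps_val R (fcoef C i))%E.

End Polygons.

Arguments newton_polytope R {K} f _.

(* Main.v *)
Require Import Defs.
From HB Require Import structures.
From mathcomp Require Import all_boot all_order all_fingroup all_algebra all_field.
From mathcomp Require Import cyclic finmap multiset.
From mathcomp Require Import boolp classical_sets functions cardinality fsbigop.
From mathcomp Require Import interval_inference reals ereal convex.
From mathcomp Require Import -(notations) mpoly.
From mathcomp Require Import zify ring lra.
Set Implicit Arguments.
Unset Strict Implicit.
Unset Printing Implicit Defensive.
Import Order.TTheory GRing.Theory Num.Theory.
Local Open Scope classical_set_scope.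
Local Open Scope ring_scope.

(** Only T-adic valuations enter the two polygons, and all coefficients lie in
fields of characteristic 0; p-adic arguments are needed only to understand the
unramified extensions and their traces.

Expand (1 + T)^y as the sum of the beta_m y^m: each beta_m is divisible by T^m
([binom_coef]).  Let F_j be the series (1 + T)^f where the coefficients of f
are replaced by the p^j-th powers of their Teichmueller lifts.  As f^m is
supported in the m-fold dilation of the triangle, the coefficient of x^P in
F_j vanishes off the cone and is divisible by T^e for e the ceiling of w(P)
([filtered_series]).  The trace of an unramified extension of degree r is the
sum of r conjugates, the j-th of which raises Teichmueller lifts to the power
p^j ([trace_conjugates]).  Hence the summand of the exponential sum at x is the
product of the F_j(x^(p^j)) for j < n k ([exp_sum_term]).

Dwork's argument then computes the sum over x, which retains the exponents
divisible by q^k - 1.  The coefficient of the product of the F_i(x^(p^i)),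
i < j, at p^j Q - P is the (P, Q) entry of A_0 ... A_(j-1), where the entry
(P, Q) of A_i is the coefficient of F_i at p Q - P ([Frob_matrix]).  Modulo T^N
only the finitely many points of weight at most N / (p - 1) matter, since
steps towards heavier points are divisible by T^N.  So, modulo T^N, the k-th
exponential sum divided by (q^k - 1)^2 is the trace of A_0 ... A_(n k - 1)
([exp_sum_trace]).

The matrices A_i have period n in i.  Put together as the blocks of a
block-cyclic matrix Z on n copies of the points, they give a trace of Z^(n k)
equal to n times the k-th trace above, while the traces of the other powers of
Z vanish ([trace_cyclic_mx]).  Newton's identities on one side and the
differential equation of the exponential on the other show that det(1 - s Z) =
C(s^n) modulo T^N ([series_compare]); the matrix Z stands for the semilinear
Dwork operator, extended to the n conjugates.  Therefore u_i is a coefficient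
of a determinant, and by Leibniz' formula a sum of products of entries Z_(P,
tau(P)), where P runs over a multiset S of n i points of n copies of the cone
and tau permutes S.  Such a product has valuation at least the sum of the
ceilings of w(p tau(P) - P), hence at least h(S) ([newton_point]).  So at each
abscissa the point that defines the Newton polygon lies on or above the one
that defines the improved Hodge polygon, and the same holds for the hulls
([lower_hull_le]).

The exponential sums for the various k live over different extensions.  These
are compared through the powers of a Teichmueller lift, which form a basis of
the integers by p-adic expansion ([integer_span]); it follows that an extension
embeds into the others compatibly with Teichmueller lifts ([teich_embedding]). *)

(** * p-adic integers *)

Section PadicIntegers.
Variables (p : nat) (p_pr : prime p).
Local Notation Zp := (padic_int p_pr).
Local Notation P m := ((p ^ m)%N%:Z).

Let P_gt0 m : (0 < P m)%R.
Proof. by rewrite ltz_nat expn_gt0 prime_gt0. Qed.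

Lemma padic_rep_int (z : int) m : padic_rep (z%:~R : Zp) m = (z %% P m)%Z.
Proof.
suff -> : (z%:~R : Zp) = padic_const p_pr z by [].
have nat_const (k : nat) : (k%:R : Zp) = padic_const p_pr k.
  elim: k => [|k IHk] //; rewrite -addn1 natrD IHk.
  by apply: padic_eq => m' /=; rewrite modzDm.
case: z => k; first exact: nat_const.
rewrite NegzE mulrNz -[k.+1%:~R]/(k.+1%:R) nat_const.
by apply: padic_eq => m' /=; rewrite modzNm.
Qed.

Lemma padic_rep_nat (k : nat) m : padic_rep (k%:R : Zp) m = (k%:Z %% P m)%Z.
Proof. exact: (padic_rep_int k). Qed.

Lemma padic_repD (a b : Zp) m :
  padic_rep (a + b) m = ((padic_rep a m + padic_rep b m)%R %% P m)%Z.
Proof. by []. Qed.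

Lemma padic_repM (a b : Zp) m :
  padic_rep (a * b) m = ((padic_rep a m * padic_rep b m)%R %% P m)%Z.
Proof. by []. Qed.

Lemma padic_repB (a b : Zp) m :
  padic_rep (a - b) m = ((padic_rep a m - padic_rep b m)%R %% P m)%Z.
Proof. by rewrite padic_repD /= modzDmr. Qed.

Lemma padic_rep0 m : padic_rep (0 : Zp) m = 0.
Proof. by rewrite /= mod0z. Qed.

Lemma padic_rep_pM (b : Zp) m : padic_rep ((p ^ m)%:R * b) m = 0.
Proof. by rewrite padic_repM padic_rep_nat modzz mul0r mod0z. Qed.

Lemma padic_dvd_rep (a : Zp) m : padic_rep a m = 0 ->
  exists b, a = (p ^ m)%:R * b.
Proof.
move=> am0; have divP k : (padic_rep a (m + k) %/ P m)%Z * P m = padic_rep a (m + k).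
  apply: divzK; apply/dvdz_mod0P.
  by rewrite padic_rep_le ?leq_addr.
have compat k : ((padic_rep a (m + k.+1) %/ P m)%Z %% P k)%Z =
    (padic_rep a (m + k) %/ P m)%Z.
  apply: (mulfI (x := P m)); first by rewrite gt_eqF.
  rewrite [RHS]mulrC divP mulz_modr // mulrC divP -PoszM -expnD.
  by rewrite addnS padic_repP.
exists (PadicInt p_pr compat); apply: padic_eq => k /=.
by rewrite padic_rep_nat modzMml mulrC divP padic_rep_le ?leq_addl.
Qed.

(** The residues of the partial sums modulo p^m stabilise, hence form a
compatible sequence. *)
Lemma padic_series (B : nat -> Zp) : exists A : Zp, forall M, exists C,
  A = \sum_(i < M) (p ^ i)%:R * B i + (p ^ M)%:R * C.
Proof.
pose f m := padic_rep (\sum_(i < m) (p ^ i)%:R * B i) m.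
have fP m : (f m.+1 %% P m)%Z = (f m %% P m)%Z.
  rewrite /f padic_rep_mod padic_repP big_ord_recr.
  by rewrite padic_repD padic_rep_pM addr0 padic_rep_mod.
exists (padic_of p_pr fP) => M.
have [|C AC] := @padic_dvd_rep (padic_of p_pr fP - \sum_(i < M) (p ^ i)%:R * B i) M.
  by rewrite padic_repB /= /f !padic_rep_mod addrN mod0z.
by exists C; rewrite -AC addrC subrK.
Qed.

Lemma padic_digit (a : Zp) : exists b, a = (padic_rep a 1)%:~R + p%:R * b.
Proof.
have [|b ab] := @padic_dvd_rep (a - (padic_rep a 1)%:~R) 1.
  by rewrite padic_repB padic_rep_int padic_rep_mod addrN mod0z.
by exists b; rewrite [X in _ = X]addrC -[p%:R]/((p ^ 1)%:R) -ab subrK.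
Qed.

Lemma padic_nat_neq0 k : (0 < k)%N -> (k%:R : Zp) != 0.
Proof.
move=> k_gt0; apply/eqP => /(congr1 (fun a => padic_rep a k)).
rewrite padic_rep_nat padic_rep0 modz_small ?ltz_nat ?lez_nat /=; last first.
  by rewrite ltn_expl ?prime_gt1.
by move/eqP; rewrite eqz_nat; case: k k_gt0.
Qed.

(** The exponent c is one less than the least precision at which some [a i] has
a nonzero representative. *)
Lemma padic_primitive (I : finType) (a : I -> Zp) : (exists i, a i != 0) ->
  exists c (b : I -> Zp), (forall i, a i = (p ^ c)%:R * b i) /\
    exists i, padic_rep (b i) 1 != 0.
Proof.
case=> i0 /padic_neq0[m am].
pose bad c := [exists i, padic_rep (a i) c != 0].
have exbad : exists c, bad c by exists m; apply/existsP; exists i0.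
case: (ex_minnP exbad) => -[|c] /existsP[i ai] min_c.
  by move: ai; rewrite -[padic_rep _ _]padic_rep_mod expn0 modz1 eqxx.
have a0 j : padic_rep (a j) c = 0.
  apply/eqP/negPn/negP => aj.
  have /min_c : bad c by apply/existsP; exists j.
  by rewrite ltnn.
have /(_ _)/cid-/all_sig[b ab] := fun j => padic_dvd_rep (a0 j).
exists c, b; split=> //; exists i.
apply: contraNneq ai => bi0; have [d bd] := padic_dvd_rep bi0.
by rewrite ab bd mulrA -natrM -expnD addn1 padic_rep_pM.
Qed.

End PadicIntegers.

(** * Integers of an unramified extension *)

Section PrimeField.
Variables (p : nat) (p_pr : prime p).
Local Notation Zp := (padic_int p_pr).

Lemma Fp_natr_p : (p%:R : 'F_p) = 0.
Proof. by have /andP[_ /eqP] := pchar_Fp p_pr. Qed.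

Lemma charK_natr (K : fieldType) (iota : {rmorphism 'F_p -> K}) : (p%:R : K) = 0.
Proof.
have := rmorph0 iota; have /(congr1 iota) := Fp_natr_p; rewrite rmorph_nat => -> <-.
by congr (iota _).
Qed.

Lemma Fp_intr_mod (z : int) : ((z %% (p ^ 1)%N%:Z)%Z%:~R : 'F_p) = z%:~R.
Proof.
have := congr1 (fun t : int => t%:~R : 'F_p) (divz_eq z (p ^ 1)%N%:Z).
rewrite /= => ->; rewrite expn1; set x := (z %/ _)%Z; set y := (z %% _)%Z.
by rewrite [RHS]intrD intrM -[X in _ * X + _]/(p%:R) Fp_natr_p mulr0 add0r.
Qed.

Definition padic_residue (a : Zp) : 'F_p := (padic_rep a 1)%:~R.

Fact padic_residue_zmod : zmod_morphism padic_residue.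
Proof. by move=> a b; rewrite /padic_residue padic_repB Fp_intr_mod intrB. Qed.

Fact padic_residue_monoid : monoid_morphism padic_residue.
Proof.
split=> [|a b]; first exact: (etrans (congr1 _ (padic_rep_int p_pr 1 1)) (Fp_intr_mod 1)).
by rewrite /padic_residue padic_repM Fp_intr_mod intrM.
Qed.

HB.instance Definition _ :=
  GRing.isZmodMorphism.Build Zp 'F_p padic_residue padic_residue_zmod.
HB.instance Definition _ :=
  GRing.isMonoidMorphism.Build Zp 'F_p padic_residue padic_residue_monoid.

Lemma padic_residue_neq0 (a : Zp) : padic_rep a 1 != 0 -> padic_residue a != 0.
Proof.
apply: contraNneq; rewrite /padic_residue.
have := padic_rep_mod a 1; rewrite expn1.
case: (padic_rep a 1) => [k|k] ak.
  move/(congr1 val); rewrite /= -[k%:~R]/(k%:R) val_Fp_nat //.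
  by move: ak; rewrite modz_nat => -[->] ->.
by have := @modz_ge0 (Negz k) p; rewrite ak eqz_nat -lt0n prime_gt0 // => /(_ isT).
Qed.

End PrimeField.

Lemma fraction_numden (R : idomainType) (x : {fraction R}) :
  exists a d : R, d != 0 /\ x * tofrac d = tofrac a.
Proof.
elim/quotW: x => r; exists \n_r, \d_r; split; first exact: denom_ratioP.
unlock tofrac; rewrite -[LHS]FracField.pi_mul; apply/eqmodP.
rewrite /= FracField.equivfE /FracField.mulf.
by rewrite !(numden_Ratio, oner_eq0, mulf_neq0, denom_ratioP, mulr1) // mulrC.
Qed.

Lemma fraction_poly_denom (R : idomainType) (h : {poly {fraction R}}) :
  exists (d : R) (h' : {poly R}), d != 0 /\ tofrac d *: h = map_poly (@tofrac R) h'.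
Proof.
elim/poly_ind: h => [|h c [d [h' [d0 dh]]]].
  by exists 1, 0; rewrite oner_neq0 scaler0 rmorph0.
have [a [e [e0 ce]]] := fraction_numden c.
exists (d * e), ((e *: h') * 'X + (d * a)%:P); split; first by rewrite mulf_neq0.
rewrite rmorphD /= [map_poly _ (_ * _)]rmorphM /= map_polyX map_polyC map_polyZ /= -dh.
rewrite scalerDr scalerAl scalerA rmorphM /= [tofrac e * _]mulrC; congr (_ + _).
by rewrite -mul_polyC -polyCM -mulrA [tofrac e * _]mulrC ce tofracM.
Qed.

Definition padic_emb (p : nat) (p_pr : prime p) (E : fieldExtType (padic p_pr)) :
  padic_int p_pr -> E := in_alg E \o @tofrac (padic_int p_pr).

HB.instance Definition _ p p_pr E :=
  GRing.RMorphism.copy (@padic_emb p p_pr E) (in_alg E \o @tofrac (padic_int p_pr)).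

Section Unramified.
Variables (p : nat) (p_pr : prime p) (K : fieldType) (iota : {rmorphism 'F_p -> K}).
Variables (Q : nat) (L : unramified_ext p_pr K Q).
Local Notation Zp := (padic_int p_pr).
Local Notation emb := (@padic_emb p p_pr L).
Local Notation O := (@ring_of_integers p p_pr L).
Local Notation red := (@ur_red p p_pr K Q L).

Lemma emb_eq0 (a : Zp) : (emb a == 0) = (a == 0).
Proof. by rewrite -[emb a]/(in_alg L (tofrac a)) fmorph_eq0 tofrac_eq0. Qed.

Lemma ur_natr_neq0 k : (0 < k)%N -> (k%:R : L) != 0.
Proof.
by move=> k0; rewrite -(rmorph_nat emb) emb_eq0 padic_nat_neq0.
Qed.

Lemma integer_emb a : O (emb a).
Proof. exact: (integral_id emb). Qed.

Lemma integer_nat k : O k%:R.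
Proof. by rewrite -(rmorph_nat emb); apply: integer_emb. Qed.

Lemma integer0 : O 0. Proof. exact: (integer_nat 0). Qed.
Lemma integer1 : O 1. Proof. exact: (integer_nat 1). Qed.

Lemma integerD x y : O x -> O y -> O (x + y).
Proof. exact: (integral_add (RtoK := emb)). Qed.
Lemma integerN x : O x -> O (- x).
Proof. exact: (integral_opp (RtoK := emb)). Qed.
Lemma integerB x y : O x -> O y -> O (x - y).
Proof. exact: (integral_sub (RtoK := emb)). Qed.
Lemma integerM x y : O x -> O y -> O (x * y).
Proof. exact: (integral_mul (RtoK := emb)). Qed.

Lemma integerX x k : O x -> O (x ^+ k).
Proof.
move=> Ox; elim: k => [|k IHk]; first exact: integer1.
by rewrite exprS; apply: integerM.
Qed.

Lemma integer_sum (I : Type) (s : seq I) (P : pred I) (F : I -> L) :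
  (forall i, P i -> O (F i)) -> O (\sum_(i <- s | P i) F i).
Proof. by move=> OF; apply: (big_ind O) => //; [exact: integer0|exact: integerD]. Qed.

Lemma integer_horner (h : {poly Zp}) x : O x -> O (map_poly emb h).[x].
Proof.
move=> Ox; rewrite horner_coef; apply: integer_sum => i _.
by rewrite coef_map; apply: integerM; [apply: integer_emb|apply: integerX].
Qed.

Lemma redD x y : O x -> O y -> red (x + y) = red x + red y.
Proof. by move=> Ox Oy; apply: ur_redD; apply: mem_set. Qed.

Lemma redM x y : O x -> O y -> red (x * y) = red x * red y.
Proof. by move=> Ox Oy; apply: ur_redM; apply: mem_set. Qed.

Lemma red0 : red 0 = 0.
Proof. by apply: (addrI (red 0)); rewrite -redD ?addr0 //; apply: integer0. Qed.

Lemma redN x : O x -> red (- x) = - red x.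
Proof.
move=> Ox; apply: (addIr (red x)); rewrite -redD ?addNr ?red0 //.
exact: integerN.
Qed.

Lemma redX x k : O x -> red (x ^+ k) = red x ^+ k.
Proof.
move=> Ox; elim: k => [|k IHk]; first exact: ur_red1.
by rewrite !exprS redM ?IHk //; apply: integerX.
Qed.

Lemma red_nat k : red k%:R = k%:R.
Proof.
elim: k => [|k IHk]; first exact: red0.
by rewrite -addn1 !natrD redD ?IHk ?ur_red1 //; [apply: integer_nat|apply: integer1].
Qed.

Lemma red_emb a : red (emb a) = iota (padic_residue a).
Proof.
have [b {1}->] := padic_digit a; rewrite rmorphD rmorphM /= rmorph_nat rmorph_int.
have Opb : O (p%:R * emb b) by apply: integerM; [exact: integer_nat|exact: integer_emb].
have Oint z : O z%:~R by rewrite -(rmorph_int emb); apply: integer_emb.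
rewrite redD // redM ?red_nat; [|exact: integer_nat|exact: integer_emb].
rewrite (charK_natr p_pr iota) mul0r addr0.
rewrite /padic_residue rmorph_int; case: (padic_rep a 1) => k.
  exact: red_nat.
by rewrite NegzE !mulrNz redN // -[k.+1%:~R]/(k.+1%:R) red_nat.
Qed.

Lemma red_horner (h : {poly Zp}) x : O x ->
  red (map_poly emb h).[x] = (map_poly (iota \o @padic_residue p p_pr) h).[red x].
Proof.
move=> Ox; elim/poly_ind: h => [|h c IHh]; first by rewrite !rmorph0 !horner0 red0.
rewrite !rmorphD !rmorphM /= !map_polyX !map_polyC !hornerMXaddC.
have OhX : O ((map_poly emb h).[x] * x) by apply: integerM => //; apply: integer_horner.
rewrite redD // ?redM ?IHh ?red_emb //; first exact: integer_horner.
exact: integer_emb.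
Qed.

Definition ur_congr m (x y : L) := exists2 z, O z & x - y = (p ^ m)%:R * z.

Lemma red_congr x y : O x -> O y -> red x = red y -> ur_congr 1 x y.
Proof.
move=> Ox Oy xy; have Oxy : O (x - y) by apply: integerB.
have [] := ur_red_ker Oxy => + _; case.
  by rewrite redD // ?redN ?xy ?subrr //; apply: integerN.
by move=> z Oz xyz; exists z; rewrite ?expn1.
Qed.

Lemma congr_red x y : O x -> O y -> ur_congr 1 x y -> red x = red y.
Proof.
move=> Ox Oy [z Oz]; rewrite expn1 => /eqP; rewrite subr_eq => /eqP ->.
rewrite redD // ?redM ?red_nat //; try exact: integer_nat.
  by rewrite (charK_natr p_pr iota) mul0r add0r.
by apply: integerM => //; exact: integer_nat.
Qed.

Lemma ur_congr_sym m x y : ur_congr m x y -> ur_congr m y x.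
Proof. by case=> z Oz xy; exists (- z); [exact: integerN|rewrite mulrN -xy opprB]. Qed.

Lemma ur_congr_trans m y x z : ur_congr m x y -> ur_congr m y z -> ur_congr m x z.
Proof.
case=> u Ou xy [v Ov yz]; exists (u + v); first exact: integerD.
by rewrite mulrDr -xy -yz addrA subrK.
Qed.

Lemma ur_congr_le m k x y : (k <= m)%N -> ur_congr m x y -> ur_congr k x y.
Proof.
move=> km [u Ou xy]; exists ((p ^ (m - k))%:R * u).
  by apply: integerM => //; exact: integer_nat.
by rewrite mulrA -natrM -expnD subnKC.
Qed.

Lemma ur_congrX m x y k : O x -> O y -> ur_congr m x y -> ur_congr m (x ^+ k) (y ^+ k).
Proof.
move=> Ox Oy [z Oz xy]; exists (z * \sum_(i < k) x ^+ (k.-1 - i) * y ^+ i).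
  by apply: integerM => //; apply: integer_sum => i _; apply: integerM; apply: integerX.
by rewrite subrXX xy mulrA.
Qed.

(** The cofactor of x - y in x^p - y^p is congruent to p y^(p-1), that is to 0,
modulo p. *)
Lemma ur_congr_powp m x y : O x -> O y -> (0 < m)%N -> ur_congr m x y ->
  ur_congr m.+1 (x ^+ p) (y ^+ p).
Proof.
move=> Ox Oy m0 xy; have xy1 : ur_congr 1 x y by apply: ur_congr_le xy.
have : ur_congr 1 (\sum_(i < p) x ^+ (p.-1 - i) * y ^+ i) 0.
  have [v Ov] : ur_congr 1 (\sum_(i < p) x ^+ (p.-1 - i) * y ^+ i) (\sum_(i < p) y ^+ p.-1).
    apply: red_congr; try by apply: integer_sum => i _; try apply: integerM; apply: integerX.
    have redS F : (forall i : 'I_p, O (F i)) -> red (\sum_(i < p) F i) = \sum_(i < p) red (F i).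
      move=> OF; pose R1 a b := O a /\ red a = b.
      suff [] : R1 (\sum_(i < p) F i) (\sum_(i < p) red (F i)) by [].
      apply: (big_rec2 R1); first by split; [exact: integer0|exact: red0].
      by move=> i a b _ [Oa <-]; split; [exact: integerD|rewrite redD].
    rewrite !redS; try by move=> i; try apply: integerM; apply: integerX.
    apply: eq_bigr => i _; rewrite redM; try exact: integerX.
    rewrite !redX // (congr_red Ox Oy xy1) -exprD; congr (_ ^+ _).
    by have := ltn_ord i; lia.
  rewrite sumr_const card_ord => Dv; exists (v + y ^+ p.-1).
    by apply: integerD => //; exact: integerX.
  by rewrite subr0 mulrDr -Dv expn1 mulr_natl subrK.
case=> u Ou; rewrite subr0 => Du; case: xy => v Ov Dxy.
exists (v * u); first exact: integerM.
by rewrite subrXX Dxy Du mulrACA -natrM -expnD addn1.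
Qed.

(** If d is a common denominator of the coefficients of a monic polynomial of
degree D that vanishes at x, then multiplying by d^D exhibits d x as a root of
a monic polynomial with integral coefficients. *)
Lemma integer_denominator x : exists2 d : Zp, d != 0 & O (emb d * x).
Proof.
have /polyOver1P[q Dq] := minPolyOver 1%AS x.
have q_mon : q \is monic by have := monic_minPoly 1%AS x; rewrite Dq map_monic.
have qx0 : root (map_poly (in_alg L) q) x by rewrite -Dq root_minPoly.
have [d [h [d0 dh]]] := fraction_poly_denom q.
exists d => //; set D := (size q).-1.
have szq : size q = D.+1 by rewrite /D prednK // size_poly_gt0 monic_neq0.
pose g : {poly L} := \poly_(i < D.+1) (emb d ^+ (D - i) * (q`_i)%:A).
have gD : g`_D = 1.
  by rewrite coef_poly ltnSn subnn expr0 mul1r -[D]/((size q).-1) -lead_coefE (monicP q_mon) scale1r.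
have g_mon : g \is monic.
  have szg : size g = D.+1.
    apply/eqP; rewrite eqn_leq size_poly /= ltnNge; apply/negP => /leq_sizeP/(_ D (leqnn _)).
    by rewrite gD => /eqP; rewrite oner_eq0.
  by rewrite monicE lead_coefE szg /= gD.
apply: (@integral_root_monic _ _ emb _ g g_mon).
  apply/rootP; rewrite horner_poly.
  transitivity (emb d ^+ D * (map_poly (in_alg L) q).[x]); last first.
    by rewrite (rootP qx0) mulr0.
  rewrite horner_coef size_map_poly szq big_distrr /=; apply: eq_bigr => i _.
  rewrite coef_map exprMn -[X in _ = emb d ^+ X * _](subnK (leq_ord i)) exprD.
  by rewrite -!mulrA; congr (_ * _); rewrite mulrCA.
apply/(integral_poly emb) => i; rewrite coef_poly; case: ifP => [iD|_]; last exact: integer0.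
have [Di|iD'] := ltnP i D; last first.
  have -> : i = D by lia.
  have := gD; rewrite coef_poly ltnSn => ->; exact: integer1.
have -> : (D - i = (D - i.+1).+1)%N by lia.
rewrite exprSr -mulrA; apply: integerM; first by apply: integerX; exact: integer_emb.
have -> : emb d * (q`_i)%:A = emb h`_i; last exact: integer_emb.
by rewrite -[emb d]/(in_alg L (tofrac d)) -[emb h`_i]/(in_alg L (tofrac h`_i)) -coef_map -dh coefZ -rmorphM.
Qed.

End Unramified.

(** * p-adic expansions *)

Section ResidueField.
Variables (p : nat) (p_pr : prime p) (K : fieldType) (iota : {rmorphism 'F_p -> K}).
Variables (r : nat) (r_gt0 : (0 < r)%N).
Variables (Q : nat) (DQ : Q = (p ^ r)%N).
Variables (g : K) (g_prim : Q.-1.-primitive_root g).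

Lemma ppow_gt1 : (1 < Q)%N.
Proof. by rewrite DQ -[1%N](expn0 p) ltn_exp2l // prime_gt1. Qed.

Lemma ppow_predK : Q.-1.+1 = Q.
Proof. by rewrite prednK // ltnW ?ppow_gt1. Qed.

Lemma finite_subfield_exp k : g ^+ k ^+ Q = g ^+ k.
Proof.
by rewrite exprAC -[in g ^+ Q]ppow_predK exprSr (prim_expr_order g_prim) mul1r.
Qed.

Lemma finite_subfieldP (x : K) : x ^+ Q = x -> x = 0 \/ exists2 k, (k < Q.-1)%N & x = g ^+ k.
Proof.
move=> xQ; have [->|x0] := eqVneq x 0; [by left|right].
have /(prim_rootP g_prim)[k ->] : x ^+ Q.-1 = 1.
  by apply: (mulfI x0); rewrite -exprS ppow_predK xQ mulr1.
by exists k.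
Qed.

Let subfield_seq : seq K := 0 :: [seq g ^+ (nat_of_ord i) | i : 'I_Q.-1].

Lemma primitive_root_neq0 : g != 0.
Proof. by rewrite (prim_root_eq0 g_prim) -lt0n -ltnS ppow_predK ppow_gt1. Qed.

Let subfield_uniq : uniq subfield_seq.
Proof.
rewrite /= map_inj_in_uniq ?enum_uniq ?andbT => [|i j _ _ /eqP].
  apply/mapP => -[i _ /esym/eqP].
  by rewrite expf_eq0 (negbTE primitive_root_neq0) ?andbF.
by rewrite (eq_prim_root_expr g_prim) !modn_small ?ltn_ord // => /eqP/val_inj.
Qed.

Let subfield_size : size subfield_seq = Q.
Proof. by rewrite /= size_map -cardE card_ord ppow_predK. Qed.

Let subfield_mem x : x ^+ Q = x -> x \in subfield_seq.
Proof.
case/finite_subfieldP => [->|[k kQ ->]]; rewrite inE ?eqxx //; apply/orP; right.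
by apply/mapP; exists (Ordinal kQ); rewrite ?mem_enum.
Qed.

Local Notation ev h := (map_poly iota h).[g].

Let ev_seq d : seq K := [seq ev (rVpoly v) | v : 'rV['F_p]_d].
Let ev_size d : size (ev_seq d) = (p ^ d)%N.
Proof. by rewrite size_map -cardE card_mx card_Fp // mul1n. Qed.

Let ev_mem d (h : {poly 'F_p}) : (size h <= d)%N -> ev h \in ev_seq d.
Proof.
by move=> hd; apply/mapP; exists (poly_rV h); rewrite ?mem_enum ?poly_rV_K.
Qed.

(** The nonzero elements of the field are powers of g.  A relation of degree
less than r would express each of them by a polynomial in g of still smaller
degree, and there are only p^(r-1) such polynomials. *)
Lemma residue_indep (h : {poly 'F_p}) : (size h <= r)%N -> ev h = 0 -> h = 0.
Proof.
move=> hr eh0; apply/eqP/negPn/negP => h0.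
have : {subset subfield_seq <= ev_seq r.-1}.
  suff sub x : x \in subfield_seq -> exists2 u : {poly 'F_p}, (size u < size h)%N & x = ev u.
    move=> x /sub[u uh ->]; apply: ev_mem.
    by rewrite -ltnS prednK // (leq_trans uh).
  rewrite inE => /orP[/eqP->|/mapP[k _ ->]].
    by exists 0; rewrite ?rmorph0 ?horner0 // size_poly0 size_poly_gt0.
  exists ('X^k %% h); first by rewrite ltn_modp.
  have := divp_eq 'X^k h => /(congr1 (fun u => ev u)).
  rewrite rmorphD rmorphM /= hornerD hornerM eh0 mulr0 add0r => <-.
  by rewrite map_polyXn hornerXn.
move/(uniq_leq_size subfield_uniq); rewrite subfield_size ev_size.
by rewrite DQ leq_exp2l ?prime_gt1 // leqNgt prednK // leqnn.
Qed.

(** By [residue_indep] the p^r polynomials of degree less than r have distinct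
values at g, all in the field with p^r elements. *)
Lemma residue_span (x : K) : x ^+ Q = x ->
  exists2 h : {poly 'F_p}, (size h <= r)%N & x = ev h.
Proof.
move=> xQ.
have pK : p \in [pchar K] by rewrite inE p_pr (charK_natr p_pr iota) eqxx.
have evQ h : ev h ^+ Q = ev h.
  have QK : [pchar K].-nat Q by rewrite DQ pnatX (pnatE _ p_pr) pK.
  elim/poly_ind: h => [|h c IHh].
    by rewrite rmorph0 horner0 expr0n DQ expn_eq0 eqn0Ngt prime_gt0.
  rewrite rmorphD rmorphM /= map_polyX map_polyC hornerMXaddC exprDn_pchar //.
  rewrite exprMn IHh -[g]expr1 finite_subfield_exp expr1 -rmorphXn /=; congr (_ + iota _).
  rewrite DQ; elim: (r) => [|m IHm]; rewrite ?expn0 ?expr1 // expnSr exprM IHm.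
  by have := expf_card c; rewrite (card_Fp p_pr).
have ev_uniq : uniq (ev_seq r).
  rewrite map_inj_in_uniq ?enum_uniq // => u v _ _ /eqP; rewrite -subr_eq0.
  rewrite -hornerN -hornerD -rmorphN -rmorphD /= -linearN -linearD /=.
  move=> /eqP/residue_indep; rewrite size_poly => /(_ isT)/(congr1 (@poly_rV _ r)).
  by rewrite rVpolyK linear0 => /eqP; rewrite subr_eq0 => /eqP.
have sub : {subset ev_seq r <= subfield_seq}.
  by move=> y /mapP[v _ ->]; apply: subfield_mem; apply: evQ.
have [|_ Deq] := uniq_min_size ev_uniq sub; first by rewrite ev_size subfield_size DQ.
have := subfield_mem xQ; rewrite -Deq => /mapP[v _ ->].
by exists (rVpoly v); rewrite ?size_poly.
Qed.

End ResidueField.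

Section UnramifiedBasis.
Variables (p : nat) (p_pr : prime p) (K : fieldType) (iota : {rmorphism 'F_p -> K}).
Variables (r : nat) (r_gt0 : (0 < r)%N).
Variables (Q : nat) (DQ : Q = (p ^ r)%N).
Variables (g : K) (g_prim : Q.-1.-primitive_root g).
Variable L : unramified_ext p_pr K Q.
Local Notation Zp := (padic_int p_pr).
Local Notation emb := (@padic_emb p p_pr L).
Local Notation O := (@ring_of_integers p p_pr L).
Local Notation red := (@ur_red p p_pr K Q L).
Local Notation congr_mod := (@ur_congr p p_pr K Q L).

(** If y is nonzero, some nonzero p-adic integer d is a multiple of y, hence of
every power of p; but d = p^c b with the reduction of b nonzero. *)
Lemma congr_all_eq0 y : (forall m, congr_mod m y 0) -> y = 0.
Proof.
move=> y0; apply/eqP/negPn/negP => yn0.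
have [d d0 Ody] := integer_denominator y^-1.
have [|c [b [Dd bneq]]] := @padic_primitive p p_pr unit (fun=> d).
  by exists tt.
have b1 : padic_rep (b tt) 1 != 0 by case: bneq => -[].
have [z Oz] := y0 c.+1; rewrite subr0 => Dy.
have : red (emb (b tt)) = red 0.
  apply: (congr_red iota); [exact: integer_emb|exact: integer0|].
  exists (emb d * y^-1 * z); first exact: integerM.
  rewrite subr0; have pc0 : ((p ^ c)%:R : L) != 0.
    by rewrite ur_natr_neq0 // expn_gt0 prime_gt0.
  apply: (mulfI pc0); transitivity (emb d).
    by rewrite (Dd tt) rmorphM rmorph_nat.
  by rewrite [RHS]mulrA -natrM -expnD addn1 mulrCA -Dy mulfVK.
rewrite (red_emb iota) red0 => /eqP; rewrite fmorph_eq0; apply/negP.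
exact: padic_residue_neq0.
Qed.

Lemma congr_all_eq x y : (forall m, congr_mod m x y) -> x = y.
Proof.
move=> xy; apply/eqP; rewrite -subr_eq0; apply/eqP/congr_all_eq0 => m.
by have [z Oz Dz] := xy m; exists z => //; rewrite subr0.
Qed.

Lemma red_finite x : O x -> red x ^+ Q = red x.
Proof.
move=> Ox; have : (red @` O) (red x) by exists x.
by rewrite ur_red_img.
Qed.

Lemma red_lift (x : K) : x ^+ Q = x -> exists2 y, O y & red y = x.
Proof.
move=> xQ; have : @finite_subfield K Q x by [].
by rewrite -(ur_red_img L) => -[y Oy <-]; exists y.
Qed.

Section Lift.
Variables (G : L) (OG : O G) (red_G : red G = g).

(** Divided by the largest possible power of p, a relation would reduce to a
nontrivial relation between the powers of g. *)
Lemma integer_indep (h : {poly Zp}) : (size h <= r)%N ->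
  (map_poly emb h).[G] = 0 -> h = 0.
Proof.
move=> hr hG; apply/eqP/negPn/negP => h0.
have [|c [b [Db [i bi]]]] := @padic_primitive p p_pr 'I_r (fun i => h`_i).
  have szh : ((size h).-1 < r)%N by rewrite prednK ?size_poly_gt0.
  by exists (Ordinal szh); rewrite /= -lead_coefE lead_coef_eq0.
pose h' := \poly_(i < r) (if insub i is Some i' then b i' else 0).
have Dh : h = (p ^ c)%:R *: h'.
  apply/polyP => j; rewrite coefZ coef_poly; case: ltnP => [jr|rj].
    by rewrite insubT -Db.
  by rewrite mulr0 nth_default // (leq_trans hr).
have : (map_poly emb h').[G] = 0.
  move: hG; rewrite Dh map_polyZ hornerZ /= => /eqP; rewrite mulf_eq0 rmorph_nat.
  by rewrite (negbTE (ur_natr_neq0 _ _)) ?expn_gt0 ?prime_gt0 // => /eqP.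
move/(congr1 red); rewrite (red_horner iota) // red0 red_G map_poly_comp /=.
move/(residue_indep p_pr r_gt0 DQ g_prim) => h'0.
have /eqP := padic_residue_neq0 bi; apply.
have := congr1 (fun u : {poly 'F_p} => u`_i) (h'0 _).
rewrite coef_map coef_poly ltn_ord coef0 valK; apply.
by rewrite (leq_trans (size_poly _ _)) ?size_poly.
Qed.

Lemma integer_digit x : O x -> exists (h : {poly Zp}) (z : L),
  [/\ O z, (size h <= r)%N & x = (map_poly emb h).[G] + p%:R * z].
Proof.
move=> Ox.
have [h hr Dh] := residue_span p_pr iota r_gt0 DQ g_prim (red_finite Ox).
pose h' : {poly Zp} := \poly_(i < size h) (val h`_i)%:R.
have h'r : (size h' <= r)%N by rewrite (leq_trans (size_poly _ _)).
have Oh' : O (map_poly emb h').[G] by apply: integer_horner.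
have [|z Oz] := @red_congr _ _ _ _ _ x (map_poly emb h').[G] Ox Oh'; last first.
  by rewrite expn1 => Dz; exists h', z; split=> //; rewrite -Dz addrC subrK.
rewrite (red_horner iota) // red_G Dh map_poly_comp /=; congr (map_poly iota _).[_].
apply/polyP => i; rewrite coef_map coef_poly; case: ltnP => hi; last first.
  by rewrite raddf0 nth_default.
by rewrite /= rmorph_nat natr_Zp.
Qed.

(** Iterating [integer_digit] yields the p-adic expansion of x, whose digits are
summed coefficient by coefficient. *)
Lemma integer_span x : O x -> exists2 h : {poly Zp},
  (size h <= r)%N & x = (map_poly emb h).[G].
Proof.
move=> Ox.
have /choice[D DP] : forall y : L, exists hz : {poly Zp} * L, O y ->
    [/\ O hz.2, (size hz.1 <= r)%N & y = (map_poly emb hz.1).[G] + p%:R * hz.2].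
  move=> y; have [Oy|nOy] := pselect (O y); last by exists (0, 0).
  by have [h [z hz]] := integer_digit Oy; exists (h, z).
(* The successive remainders of the expansion: x = sum of p^i (digit i) + p^m s_m
   for the digits read off by D. *)
pose s m := iter m (fun y => (D y).2) x.
have Os m : O (s m) by elim: m => [|m IHm] //=; case: (DP _ IHm).
have /choice[A AP] : forall j, exists A : Zp, forall M, exists C,
    A = \sum_(i < M) (p ^ i)%:R * ((D (s i)).1)`_j + (p ^ M)%:R * C.
  by move=> j; exact: (padic_series (fun i => ((D (s i)).1)`_j)).
exists (\poly_(j < r) A j); first exact: size_poly.
apply: congr_all_eq => M.
have xM : x = \sum_(i < M) (p ^ i)%:R * (map_poly emb (D (s i)).1).[G] + (p ^ M)%:R * s M.
  elim: M => [|M IHM]; first by rewrite big_ord0 add0r mul1r.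
  rewrite big_ord_recr /= [in LHS]IHM -addrA; congr (_ + _).
  have [_ _ {1}->] := DP _ (Os M); rewrite mulrDr mulrA -natrM -expnSr.
  by rewrite -/(s M.+1).
have /choice[C CP] := fun j => AP j M.
exists (s M - (map_poly emb (\poly_(j < r) C j)).[G]).
  by apply: integerB => //; apply: integer_horner.
have -> : \poly_(j < r) A j = \sum_(i < M) (p ^ i)%:R *: (D (s i)).1 + (p ^ M)%:R *: \poly_(j < r) C j.
  apply/polyP => j; rewrite coefD coefZ coef_sum !coef_poly; case: ltnP => jr.
    by rewrite CP; congr (_ + _); apply: eq_bigr => i _; rewrite coefZ.
  rewrite mulr0 addr0 big1 // => i _; rewrite coefZ nth_default ?mulr0 //.
  by have [_ + _] := DP _ (Os i); move/leq_trans; apply.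
rewrite rmorphD rmorph_sum /= map_polyZ hornerD hornerZ horner_sum rmorph_nat.
rewrite {1}xM opprD addrACA mulrBr -[RHS]add0r; congr (_ + _).
apply/eqP; rewrite subr_eq0; apply/eqP; apply: eq_bigr => i _.
by rewrite map_polyZ hornerZ rmorph_nat.
Qed.

End Lift.
End UnramifiedBasis.

(** * Teichmueller lifts *)

Section Teichmuller.
Variables (p : nat) (p_pr : prime p) (K : fieldType) (iota : {rmorphism 'F_p -> K}).
Variables (r : nat) (r_gt0 : (0 < r)%N).
Variables (Q : nat) (DQ : Q = (p ^ r)%N).
Variables (g : K) (g_prim : Q.-1.-primitive_root g).
Variable L : unramified_ext p_pr K Q.
Local Notation Zp := (padic_int p_pr).
Local Notation emb := (@padic_emb p p_pr L).
Local Notation O := (@ring_of_integers p p_pr L).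
Local Notation red := (@ur_red p p_pr K Q L).
Local Notation congr_mod := (@ur_congr p p_pr K Q L).
Local Notation tau := (teichmuller L).

(** Completeness is inherited from Z_p through the coordinates in the powers of
a lift of g. *)
Lemma integer_series (B : nat -> L) : (forall i, O (B i)) ->
  exists2 y, O y & forall M, congr_mod M y (\sum_(i < M) (p ^ i)%:R * B i).
Proof.
move=> intB.
have [G OG red_G] := red_lift L (finite_subfield_exp p_pr r_gt0 DQ g_prim 1).
rewrite expr1 in red_G.
have /choice[h hP] : forall i, exists h : {poly Zp},
    (size h <= r)%N /\ B i = (map_poly emb h).[G].
  move=> i; have [h] := integer_span iota r_gt0 DQ g_prim OG red_G (intB i).
  by exists h.
have /choice[A AP] : forall j, exists A : Zp, forall M, exists C,
    A = \sum_(i < M) (p ^ i)%:R * (h i)`_j + (p ^ M)%:R * C.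
  by move=> j; exact: (padic_series (fun i => (h i)`_j)).
exists (map_poly emb (\poly_(j < r) A j)).[G]; first exact: integer_horner.
move=> M; have /choice[C CP] := fun j => AP j M.
exists (map_poly emb (\poly_(j < r) C j)).[G]; first exact: integer_horner.
have -> : \poly_(j < r) A j = \sum_(i < M) (p ^ i)%:R *: h i + (p ^ M)%:R *: \poly_(j < r) C j.
  apply/polyP => j; rewrite coefD coefZ coef_sum !coef_poly; case: ltnP => jr.
    by rewrite CP; congr (_ + _); apply: eq_bigr => i _; rewrite coefZ.
  rewrite mulr0 addr0 big1 // => i _; rewrite coefZ nth_default ?mulr0 //.
  by have [+ _] := hP i; move/leq_trans; apply.
rewrite rmorphD rmorph_sum /= map_polyZ hornerD hornerZ horner_sum rmorph_nat.
rewrite addrAC -[RHS]add0r; congr (_ + _).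
apply/eqP; rewrite subr_eq0; apply/eqP; apply: eq_bigr => i _.
by rewrite map_polyZ hornerZ rmorph_nat; have [_ <-] := hP i.
Qed.

Lemma ur_congrQ m x y : O x -> O y -> (0 < m)%N -> congr_mod m x y ->
  congr_mod m.+1 (x ^+ Q) (y ^+ Q).
Proof.
move=> Ox Oy m0 xy.
have powQ z : z ^+ Q = (z ^+ (p ^ r.-1)) ^+ p :> L.
  by rewrite -exprM -expnSr prednK // -DQ.
by rewrite !powQ; apply: (ur_congr_powp iota) => //; [exact: integerX|exact: integerX|exact: ur_congrX].
Qed.

(** The Q-th power fixes both elements and improves any congruence between them
by a factor p. *)
Lemma teich_uniq y y' : O y -> O y' -> y ^+ Q = y -> y' ^+ Q = y' ->
  red y = red y' -> y = y'.
Proof.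
move=> Oy Oy' yQ y'Q yy'; apply: (congr_all_eq iota) => m.
apply: (@ur_congr_le _ _ _ _ _ m.+1) => //.
elim: m => [|m IHm]; first exact: red_congr.
by rewrite -yQ -y'Q; apply: ur_congrQ.
Qed.

(** For any lift y0 of x the sequence of the y0^(Q^m) converges. *)
Lemma teich_exists x : x ^+ Q = x -> exists y, [/\ O y, red y = x & y ^+ Q = y].
Proof.
move=> xQ; have [y0 Oy0 red_y0] := red_lift L xQ.
pose s m := iter m (fun y => y ^+ Q) y0.
have Os m : O (s m) by elim: m => [|m IHm] //=; apply: integerX.
have sS m : congr_mod m.+1 (s m.+1) (s m).
  elim: m => [|m IHm]; last exact: ur_congrQ (Os m.+1) (Os m) _ IHm.
  have redQ : red (y0 ^+ Q) = red y0 by rewrite redX ?red_y0.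
  exact: red_congr (integerX Q Oy0) Oy0 redQ.
have /choice[z zP] : forall m, exists z, O z /\ s m.+1 - s m = (p ^ m.+1)%:R * z.
  by move=> m; have [z] := sS m; exists z.
have [u Ou uP] := integer_series (fun i => (zP i).1).
have ys m : congr_mod m.+1 (y0 + p%:R * u) (s m).
  have [v Ov Dv] := uP m; exists v => //.
  have -> : s m = y0 + p%:R * \sum_(i < m) (p ^ i)%:R * z i.
    elim: m {v Ov Dv} => [|m IHm]; first by rewrite big_ord0 mulr0 addr0.
    rewrite big_ord_recr mulrDr addrA /= -IHm mulrA -natrM -expnS.
    by have [_ <-] := zP m; rewrite addrC subrK.
  by rewrite opprD addrACA subrr add0r -mulrBr Dv mulrA -natrM -expnS.
have Oy : O (y0 + p%:R * u) by apply: integerD => //; apply: integerM => //; exact: integer_nat.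
exists (y0 + p%:R * u); split=> //.
  by rewrite -red_y0; apply: (congr_red iota) => //; exact: (ys 0%N).
apply: (congr_all_eq iota) => m; apply: (@ur_congr_le _ _ _ _ _ m.+1) => //.
apply: (ur_congr_trans (y := s m.+1)); first by apply: ur_congrX => //; exact: ys.
by apply: ur_congr_sym; apply: ur_congr_le (ys m.+1).
Qed.

Lemma teichP x : x ^+ Q = x -> [/\ O (tau x), red (tau x) = x & tau x ^+ Q = tau x].
Proof.
move=> /teich_exists[y yP].
exact: (@xgetPex _ 0 [set y : L | [/\ O y, red y = x & y ^+ Q = y]] (ex_intro _ y yP)).
Qed.

Lemma teich_eq x y : x ^+ Q = x -> O y -> red y = x -> y ^+ Q = y -> tau x = y.
Proof.
move=> xQ Oy red_y yQ; have [Ot red_t tQ] := teichP xQ.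
by apply: teich_uniq; rewrite ?red_t.
Qed.

Lemma teichX x k : x ^+ Q = x -> tau (x ^+ k) = tau x ^+ k.
Proof.
move=> xQ; have [Ot red_t tQ] := teichP xQ; apply: teich_eq.
- by rewrite exprAC xQ.
- exact: integerX.
- by rewrite redX // red_t.
- by rewrite exprAC tQ.
Qed.

Lemma teich0 : tau 0 = 0.
Proof.
have Q0 : (Q == 0)%N = false by rewrite DQ expn_eq0 eqn0Ngt prime_gt0.
by apply: teich_eq; rewrite ?expr0n ?Q0 ?red0 //; exact: integer0.
Qed.

Lemma teich_gen : [/\ O (tau g), red (tau g) = g & tau g ^+ Q = tau g].
Proof. by apply: teichP; have := finite_subfield_exp p_pr r_gt0 DQ g_prim 1; rewrite expr1. Qed.

Lemma teich_prim : Q.-1.-primitive_root (tau g).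
Proof.
have [Ot red_t tQ] := teich_gen.
have t0 : tau g != 0.
  apply/eqP => t0; have := prim_root_eq0 g_prim; rewrite -red_t t0 red0 eqxx.
  by move/esym; rewrite eqn0Ngt (prim_order_gt0 g_prim).
have tQ1 : tau g ^+ Q.-1 = 1.
  by apply: (mulfI t0); rewrite -exprS (ppow_predK p_pr r_gt0 DQ) tQ mulr1.
have [m m_prim m_dvd] := prim_order_exists (prim_order_gt0 g_prim) tQ1.
suff -> : Q.-1 = m by [].
apply/eqP; rewrite eqn_dvd m_dvd andbT (prim_order_dvd g_prim) -{1}red_t.
by rewrite -redX // (prim_expr_order m_prim) ur_red1.
Qed.

Lemma rational_indep (h : {poly padic p_pr}) : (size h <= r)%N ->
  (map_poly (in_alg L) h).[tau g] = 0 -> h = 0.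
Proof.
have [Ot red_t _] := teich_gen => hr h0.
have [d [h' [d0 dh]]] := fraction_poly_denom h.
have td0 : tofrac d != 0 by rewrite tofrac_eq0.
suff h'0 : h' = 0.
  move: dh; rewrite h'0 rmorph0 => /eqP.
  by rewrite scaler_eq0 (negbTE td0) => /eqP.
apply: (integer_indep iota r_gt0 DQ g_prim Ot red_t).
  apply/leq_sizeP => i ri; apply/eqP; rewrite -tofrac_eq0 -coef_map -dh coefZ.
  by rewrite nth_default ?mulr0 // (leq_trans hr).
rewrite -[map_poly _ h']/(map_poly (in_alg L \o @tofrac _) h') map_poly_comp -dh.
by rewrite map_polyZ hornerZ h0 mulr0.
Qed.

Lemma rational_span (x : L) : exists2 h : {poly padic p_pr},
  (size h <= r)%N & x = (map_poly (in_alg L) h).[tau g].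
Proof.
have [Ot red_t _] := teich_gen.
have [d d0 Odx] := integer_denominator x.
have [h hr Dh] := integer_span iota r_gt0 DQ g_prim Ot red_t Odx.
have td0 : tofrac d != 0 by rewrite tofrac_eq0.
exists ((tofrac d)^-1 *: map_poly (@tofrac _) h).
  rewrite size_scale ?invr_eq0 //; apply: leq_trans hr.
  by rewrite size_poly.
rewrite map_polyZ hornerZ -map_poly_comp -[map_poly _ h]/(map_poly emb h) -Dh.
by rewrite mulrA -[emb d]/(in_alg L (tofrac d)) -rmorphM mulVf // rmorph1 mul1r.
Qed.

Lemma teich_minpoly_exists : exists m : {poly Zp}, [/\ m \is monic, size m = r.+1
  & (map_poly emb m).[tau g] = 0].
Proof.
have [Ot red_t _] := teich_gen.
have [h hr Dh] := integer_span iota r_gt0 DQ g_prim Ot red_t (integerX r Ot).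
have szm : size ('X^r - h) = r.+1 by rewrite size_polyDl size_polyXn // size_polyN ltnS.
exists ('X^r - h); split=> //.
  by rewrite monicE lead_coefDl ?size_polyN ?size_polyXn ?lead_coefXn.
by rewrite rmorphB /= map_polyXn hornerD hornerN hornerXn -Dh subrr.
Qed.

End Teichmuller.

(** * Homomorphisms between unramified extensions *)

Section Transfer.
Variables (p : nat) (p_pr : prime p) (K : fieldType) (iota : {rmorphism 'F_p -> K}).
Variables (r : nat) (r_gt0 : (0 < r)%N).
Variables (Q : nat) (DQ : Q = (p ^ r)%N).
Variables (g : K) (g_prim : Q.-1.-primitive_root g).
Variable L : unramified_ext p_pr K Q.
Local Notation Zp := (padic_int p_pr).
Local Notation emb := (@padic_emb p p_pr L).
Local Notation tau := (teichmuller L).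

Lemma charK_mem : p \in [pchar K].
Proof. by rewrite inE p_pr (charK_natr p_pr iota) eqxx. Qed.

Lemma horner_Frobenius (h : {poly 'F_p}) (x : K) j :
  (map_poly iota h).[x ^+ (p ^ j)] = (map_poly iota h).[x] ^+ (p ^ j).
Proof.
have QK : [pchar K].-nat (p ^ j)%N by rewrite pnatX (pnatE _ p_pr) charK_mem.
elim/poly_ind: h => [|h c IHh].
  by rewrite rmorph0 !horner0 expr0n expn_eq0 eqn0Ngt prime_gt0.
rewrite rmorphD rmorphM /= map_polyX map_polyC !hornerMXaddC exprDn_pchar //.
rewrite exprMn IHh -rmorphXn /=; congr (_ + iota _).
elim: {QK IHh} j => [|m IHm]; rewrite ?expn0 ?expr1 // expnSr exprM -IHm.
by have := expf_card c; rewrite (card_Fp p_pr).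
Qed.

(** Write X^(Q-1) - 1 = h m.  Modulo p this polynomial is separable and m vanishes
at g^(p^j), so h does not; hence h(z) is nonzero, while h(z) m(z) = 0. *)
Lemma minpoly_transfer (m : {poly Zp}) (Q' : nat) (L' : unramified_ext p_pr K Q') (z : L') j :
    m \is monic -> size m = r.+1 -> (map_poly emb m).[tau g] = 0 ->
    ring_of_integers z -> z ^+ Q = z -> ur_red z = g ^+ (p ^ j) ->
  (map_poly (@padic_emb p p_pr L') m).[z] = 0.
Proof.
move=> m_mon sz_m m0 Oz zQ red_z.
have [Ot red_t _] := teich_gen iota r_gt0 DQ g_prim L.
have g0 : g != 0 := primitive_root_neq0 p_pr r_gt0 DQ g_prim.
set w := g ^+ (p ^ j) in red_z; have w0 : w != 0 by rewrite expf_neq0.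
pose resK := map_poly (iota \o @padic_residue p p_pr).
have mw : (resK m).[w] = 0.
  rewrite /resK map_poly_comp horner_Frobenius -map_poly_comp.
  by rewrite -red_t -(red_horner iota) // m0 red0 expr0n expn_eq0 eqn0Ngt prime_gt0.
(* The remainder s of the division by m vanishes at the lift of g, and its degree
   is less than r. *)
pose u : {poly Zp} := 'X^(Q.-1) - 1.
have /(congr1 (fun v => (map_poly emb v).[tau g])) := Pdiv.RingMonic.rdivp_eq m_mon u.
set h := Pdiv.Ring.rdivp _ _; set s := Pdiv.Ring.rmodp _ _.
rewrite {1}/u rmorphB /= map_polyXn rmorph1 hornerD hornerN hornerXn hornerC.
rewrite [in RHS]rmorphD [in RHS]/= [in RHS]rmorphM /= hornerD hornerM m0 mulr0 add0r.
rewrite (prim_expr_order (teich_prim iota r_gt0 DQ g_prim L)) subrr => /esym s0.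
have {}s0 : s = 0.
  apply: (integer_indep iota r_gt0 DQ g_prim Ot red_t) => //.
  by rewrite -ltnS -sz_m Pdiv.Ring.ltn_rmodpN0 // monic_neq0.
have Du : u = h * m by rewrite [LHS](Pdiv.RingMonic.rdivp_eq m_mon) -/s s0 addr0.
have z0 : z != 0 by apply: contraNneq w0 => z0; rewrite -red_z z0 red0.
have zQ1 : z ^+ Q.-1 = 1.
  by apply: (mulfI z0); rewrite -exprS (ppow_predK p_pr r_gt0 DQ) zQ mulr1.
have /eqP : (map_poly (@padic_emb p p_pr L') u).[z] = 0.
  by rewrite rmorphB /= map_polyXn rmorph1 hornerD hornerN hornerXn hornerC zQ1 subrr.
rewrite Du rmorphM hornerM mulf_eq0 => /orP[/eqP hz|/eqP //].
have hw : (resK h).[w] = 0 by rewrite /resK -red_z -(red_horner iota) // hz red0.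
have : (resK u)^`().[w] = 0.
  by rewrite /resK Du rmorphM derivM hornerD !hornerM -/(resK m) -/(resK h) mw hw mulr0 mul0r addr0.
rewrite /resK rmorphB /= map_polyXn rmorph1 derivB derivXn derivC subr0.
rewrite hornerMn hornerXn -mulr_natr => /eqP; rewrite mulf_eq0 expf_eq0 (negbTE w0) andbF /=.
move=> /eqP Q1; have : (Q.-1.+1%:R : K) = 0.
  by rewrite (ppow_predK p_pr r_gt0 DQ) DQ -(prednK r_gt0) expnS natrM (charK_natr p_pr iota) mul0r.
by rewrite -addn1 natrD Q1 add0r => /eqP; rewrite oner_eq0.
Qed.

(** The polynomials that vanish at the lift of g are the multiples of m, so that
substituting z in a polynomial expression is well defined. *)
Lemma hom_exists (m : {poly Zp}) (E : fieldExtType (padic p_pr)) (z : E) :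
    m \is monic -> size m = r.+1 -> (map_poly emb m).[tau g] = 0 ->
    (map_poly (@padic_emb p p_pr E) m).[z] = 0 ->
  exists phi : {rmorphism L -> E}, (forall a, phi a%:A = a%:A) /\ phi (tau g) = z.
Proof.
move=> m_mon sz_m m0 mz0.
have /choice[P PP] : forall x : L, exists h : {poly padic p_pr},
    (size h <= r)%N /\ x = (map_poly (in_alg L) h).[tau g].
  by move=> x; have [h] := rational_span iota r_gt0 DQ g_prim x; exists h.
pose f x := (map_poly (in_alg E) (P x)).[z].
pose mF : {poly padic p_pr} := map_poly (@tofrac Zp) m.
have mF_mon : mF \is monic by apply: monic_map.
have mFt : (map_poly (in_alg L) mF).[tau g] = 0 by rewrite -map_poly_comp.
have mFz : (map_poly (in_alg E) mF).[z] = 0 by rewrite -map_poly_comp.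
have key h : f (map_poly (in_alg L) h).[tau g] = (map_poly (in_alg E) h).[z].
  rewrite /f; set x := (map_poly _ h).[_]; have [_ xP] := PP x.
  have := divp_eq (h - P x) mF; set q := _ %/ _; set s := _ %% _ => Dh.
  have := congr1 (fun v => (map_poly (in_alg L) v).[tau g]) Dh.
  rewrite rmorphB rmorphD rmorphM /= !hornerD hornerN hornerM mFt mulr0 add0r -xP subrr.
  move/esym => s0; have {}s0 : s = 0.
    apply: (rational_indep iota r_gt0 DQ g_prim _ s0).
    rewrite -ltnS -sz_m; have -> : size m = size mF.
      by rewrite size_map_poly_id0 // (monicP m_mon) rmorph1 oner_neq0.
    by rewrite ltn_modp monic_neq0.
  have := congr1 (fun v => (map_poly (in_alg E) v).[z]) Dh.
  rewrite s0 addr0 rmorphB rmorphM /= hornerD hornerN hornerM mFz mulr0 => /eqP.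
  by rewrite subr_eq0 => /eqP.
have fB : zmod_morphism f.
  move=> x y; have [_ {1}->] := PP x; have [_ {1}->] := PP y.
  by rewrite -hornerN -hornerD -rmorphN -rmorphD /= key rmorphB hornerD hornerN.
have fM : monoid_morphism f.
  split=> [|x y]; first by have := key 1; rewrite !rmorph1 !hornerC.
  have [_ {1}->] := PP x; have [_ {1}->] := PP y.
  by rewrite -hornerM -rmorphM /= key rmorphM hornerM.
pose fA := GRing.isZmodMorphism.Build L E f fB.
pose fR := GRing.isMonoidMorphism.Build L E f fM.
pose phi : {rmorphism L -> E} := HB.pack f fA fR.
exists phi; split=> /=.
  by move=> a; have := key a%:P; rewrite !map_polyC !hornerC.
by have := key 'X; rewrite !map_polyX !hornerX.
Qed.

End Transfer.

(** * The trace as a sum of conjugates *)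

Section Trace.
Variables (p : nat) (p_pr : prime p) (K : fieldType) (iota : {rmorphism 'F_p -> K}).
Variables (r : nat) (r_gt0 : (0 < r)%N).
Variables (Q : nat) (DQ : Q = (p ^ r)%N).
Variables (g : K) (g_prim : Q.-1.-primitive_root g).
Variable L : unramified_ext p_pr K Q.
Local Notation Zp := (padic_int p_pr).
Local Notation emb := (@padic_emb p p_pr L).
Local Notation tau := (teichmuller L).

Lemma teich_hom_unique (E : fieldExtType (padic p_pr)) (phi : {rmorphism L -> E}) (z : K -> E) :
    z 0 = 0 -> (forall k, phi (tau g) ^+ k = z (g ^+ k)) ->
  forall x, x ^+ Q = x -> phi (tau x) = z x.
Proof.
move=> z0 zg x xQ.
have gQ : g ^+ Q = g by have := finite_subfield_exp p_pr r_gt0 DQ g_prim 1; rewrite expr1.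
have [->|[k _ ->]] := finite_subfieldP p_pr r_gt0 DQ g_prim xQ.
  by rewrite (teich0 iota r_gt0 DQ g_prim) rmorph0 z0.
by rewrite (teichX iota r_gt0 DQ g_prim L _ gQ) rmorphXn zg.
Qed.

Lemma Frobenius_exists j : exists phi : {rmorphism L -> L},
  (forall a, phi a%:A = a%:A) /\ forall x, x ^+ Q = x -> phi (tau x) = tau x ^+ (p ^ j).
Proof.
have [m [m_mon sz_m m0]] := teich_minpoly_exists iota r_gt0 DQ g_prim L.
have [Ot red_t tQ] := teich_gen iota r_gt0 DQ g_prim L.
have [|phi [phi_sc phi_g]] := @hom_exists p p_pr K iota r r_gt0 Q DQ g g_prim L m L
    (tau g ^+ (p ^ j)) m_mon sz_m m0.
  apply: (minpoly_transfer iota r_gt0 DQ g_prim (j := j) m_mon sz_m m0).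
  - exact: integerX.
  - by rewrite exprAC tQ.
  - by rewrite redX // red_t.
exists phi; split=> //; apply: teich_hom_unique.
  by rewrite (teich0 iota r_gt0 DQ g_prim) expr0n expn_eq0 eqn0Ngt prime_gt0.
have gQ : g ^+ Q = g by have := finite_subfield_exp p_pr r_gt0 DQ g_prim 1; rewrite expr1.
by move=> k; rewrite phi_g (teichX iota r_gt0 DQ g_prim L _ gQ) exprAC.
Qed.

(** This compares the exponential sums for all k over the field of the first
one. *)
Lemma teich_embedding (r' Q' : nat) (g' : K) (L' : unramified_ext p_pr K Q') :
    (0 < r')%N -> Q' = (p ^ r')%N -> Q'.-1.-primitive_root g' ->
    (forall x : K, x ^+ Q = x -> x ^+ Q' = x) ->
  exists phi : {rmorphism L -> L'},
    (forall a, phi a%:A = a%:A) /\ forall x, x ^+ Q = x -> phi (tau x) = teichmuller L' x.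
Proof.
move=> r'_gt0 DQ' g'_prim sub.
have [m [m_mon sz_m m0]] := teich_minpoly_exists iota r_gt0 DQ g_prim L.
have gQ : g ^+ Q = g by have := finite_subfield_exp p_pr r_gt0 DQ g_prim 1; rewrite expr1.
have [Ot red_t tQ'] := teichP iota r'_gt0 DQ' g'_prim L' (sub _ gQ).
have tQ : teichmuller L' g ^+ Q = teichmuller L' g.
  by rewrite -(teichX iota r'_gt0 DQ' g'_prim L' _ (sub _ gQ)) gQ.
have [|phi [phi_sc phi_g]] := @hom_exists p p_pr K iota r r_gt0 Q DQ g g_prim L m L'
    (teichmuller L' g) m_mon sz_m m0.
  apply: (minpoly_transfer iota r_gt0 DQ g_prim (j := 0) m_mon sz_m m0) => //.
exists phi; split=> //; apply: teich_hom_unique.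
  exact: (teich0 iota r'_gt0 DQ' g'_prim).
by move=> k; rewrite phi_g (teichX iota r'_gt0 DQ' g'_prim L' _ (sub _ gQ)).
Qed.

Lemma conjugates_neq (i j : 'I_r) : (i < j)%N -> tau g ^+ (p ^ j) != tau g ^+ (p ^ i).
Proof.
move=> ij; rewrite (eq_prim_root_expr (teich_prim iota r_gt0 DQ g_prim L)).
have lt_pow (k : 'I_r) : (p ^ k < Q.-1)%N.
  have r2 : (1 < r)%N by have := ltn_ord j; lia.
  have : (p ^ k <= p ^ r.-1)%N by rewrite leq_exp2l ?prime_gt1 // -ltnS prednK.
  have : (p ^ 1 <= p ^ r.-1)%N by rewrite leq_exp2l ?prime_gt1 //; lia.
  have : (Q = p * p ^ r.-1)%N by rewrite -expnS prednK.
  by have := prime_gt1 p_pr; rewrite expn1; nia.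
by rewrite !modn_small // eqn_exp2l ?prime_gt1 // gtn_eqF.
Qed.

(** Multiplication by x becomes diagonal, with the conjugates of x as
eigenvalues, in the coordinates given by the conjugations.  These are
independent because the conjugates of the powers of the lift of g form an
invertible Vandermonde matrix. *)
Lemma trace_conjugates (sigma : 'I_r -> {rmorphism L -> L}) (x : L) :
    (forall j a, sigma j a%:A = a%:A) ->
    (forall j, sigma j (tau g) = tau g ^+ (p ^ j)) ->
  (field_trace x)%:A = \sum_j sigma j x.
Proof.
move=> sig_sc sig_g; pose b := vbasis {:L}; pose d := \dim {:L}.
have bE y : y = \sum_(l < d) coord b l y *: b`_l.
  by rewrite [LHS](coord_vbasis (memvf y)).
have sigE j y : sigma j y = \sum_(l < d) (coord b l y)%:A * sigma j b`_l.
  rewrite {1}(bE y) rmorph_sum; apply: eq_bigr => l _ /=.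
  by rewrite -[_ *: b`_l]mulr_algl rmorphM sig_sc.
have /choice[P PP] : forall y : L, exists h : {poly padic p_pr},
    (size h <= r)%N /\ y = (map_poly (in_alg L) h).[tau g].
  by move=> y; have [h] := rational_span iota r_gt0 DQ g_prim y; exists h.
have evE y : y = \sum_(i < r) ((P y)`_i)%:A * tau g ^+ i.
  have [hr {1}->] := PP y; rewrite (@horner_coef_wide _ r).
    by apply: eq_bigr => i _; rewrite coef_map.
  by rewrite (leq_trans (size_poly _ _)).
(* U and W change bases between b and the powers of the lift of g; the columns
   of V are the conjugates of b. *)
pose M : 'M[L]_d := \matrix_(i, l) (coord b l (x * b`_i))%:A.
pose U : 'M[L]_(d, r) := \matrix_(l, i) ((P b`_l)`_i)%:A.
pose W : 'M[L]_(r, d) := \matrix_(i, l) (coord b l (tau g ^+ i))%:A.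
pose V : 'M[L]_(d, r) := \matrix_(l, j) sigma j b`_l.
pose a : 'rV[L]_r := \row_j tau g ^+ (p ^ j).
pose D : 'M[L]_r := diag_mx (\row_j sigma j x).
pose N := Vandermonde r a.
have N_unit : N \in unitmx.
  rewrite unitmxE unitfE det_Vandermonde.
  apply/prodf_neq0 => i _; apply/prodf_neq0 => j ij.
  by rewrite !mxE subr_eq0 conjugates_neq.
have MV : M *m V = V *m D.
  apply/matrixP => i j; rewrite mul_mx_diag !mxE mulrC -rmorphM sigE.
  by apply: eq_bigr => l _; rewrite !mxE.
have WV : W *m V = N.
  apply/matrixP => i j; rewrite !mxE -sig_g -rmorphXn sigE.
  by apply: eq_bigr => l _; rewrite !mxE.
have VU : V = U *m N.
  apply/matrixP => l j; rewrite !mxE [in LHS](evE b`_l) rmorph_sum.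
  by apply: eq_bigr => i _; rewrite !mxE rmorphM sig_sc rmorphXn /= sig_g.
have WU : W *m U = 1%:M.
  by apply: (can_inj (mulmxK N_unit)); rewrite -mulmxA -VU WV mul1mx.
have UW : U *m W = 1%:M.
  apply/matrixP => l l'; rewrite !mxE.
  transitivity ((coord b l' b`_l)%:A : L); last first.
    by rewrite coord_free ?(basis_free (vbasisP _)) //; case: eqP => _; rewrite ?scale1r ?scale0r // eq_sym.
  rewrite [in RHS](evE b`_l) linear_sum scaler_suml; apply: eq_bigr => i _.
  by rewrite !mxE [in RHS]mulr_algl linearZ /= mulr_algl scalerA.
have MU : M *m U = U *m (N *m D *m invmx N).
  by apply: (can_inj (mulmxK N_unit)); rewrite -!mulmxA mulVmx // mulmx1 -VU MV mulmxA -VU.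
transitivity (\tr M).
  rewrite /field_trace scaler_suml /mxtrace; apply: eq_bigr => i _.
  by rewrite mxE.
rewrite -[M]mulmx1 -UW mulmxA MU -mulmxA mxtrace_mulC -!mulmxA WU mulmx1.
rewrite mxtrace_mulC -mulmxA mulVmx // mulmx1 mxtrace_diag.
by apply: eq_bigr => j _; rewrite mxE.
Qed.

End Trace.

(** * Power series in T *)

Section FpsCoef.
Variable R : comNzRingType.
Implicit Types f g : fps R.

Lemma fcoefD f g i : fcoef (f + g) i = fcoef f i + fcoef g i.
Proof. by []. Qed.

Lemma fcoefN f i : fcoef (- f) i = - fcoef f i.
Proof. by []. Qed.

Lemma fcoefZ (c : R) f i : fcoef (c *: f) i = c * fcoef f i.
Proof. by []. Qed.

Lemma fcoefM f g i : fcoef (f * g) i = \sum_(j < i.+1) fcoef f j * fcoef g (i - j).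
Proof. by []. Qed.

Lemma fcoef1 i : fcoef (1 : fps R) i = (i == 0)%N%:R.
Proof. by []. Qed.

Lemma fcoef_sum (I : Type) (s : seq I) (P : pred I) (F : I -> fps R) i :
  fcoef (\sum_(j <- s | P j) F j) i = \sum_(j <- s | P j) fcoef (F j) i.
Proof. by apply: (big_morph (fun f => fcoef f i)). Qed.

Lemma fcoef_mulr_nat f k i : fcoef (f *+ k) i = fcoef f i *+ k.
Proof. by elim: k => // k IHk; rewrite !mulrS fcoefD IHk. Qed.

(** Congruence modulo T^N. *)
Definition eqT N f g := forall i, (i < N)%N -> fcoef f i = fcoef g i.

Lemma eqT_refl N f : eqT N f f. Proof. by []. Qed.
Lemma eqT_sym N f g : eqT N f g -> eqT N g f.
Proof. by move=> fg i iN; rewrite fg. Qed.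
Lemma eqT_trans N f g h : eqT N f g -> eqT N g h -> eqT N f h.
Proof. by move=> fg gh i iN; rewrite fg ?gh. Qed.

Lemma eqTN N f f' : eqT N f f' -> eqT N (- f) (- f').
Proof. by move=> ff i iN; rewrite !fcoefN ff. Qed.

Lemma eqTM N f f' g g' : eqT N f f' -> eqT N g g' -> eqT N (f * g) (f' * g').
Proof.
move=> ff gg i iN; rewrite !fcoefM; apply: eq_bigr => j _; rewrite ff ?gg //.
  by rewrite (leq_ltn_trans (leq_subr _ _)).
by rewrite (leq_ltn_trans _ iN) // -ltnS.
Qed.

Lemma eqT_sum N (I : Type) (s : seq I) (P : pred I) (F G : I -> fps R) :
  (forall i, P i -> eqT N (F i) (G i)) ->
  eqT N (\sum_(i <- s | P i) F i) (\sum_(i <- s | P i) G i).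
Proof. by move=> FG j jN; rewrite !fcoef_sum; apply: eq_bigr => i Pi; rewrite FG. Qed.

Lemma eqT_prod N (I : Type) (s : seq I) (P : pred I) (F G : I -> fps R) :
  (forall i, P i -> eqT N (F i) (G i)) ->
  eqT N (\prod_(i <- s | P i) F i) (\prod_(i <- s | P i) G i).
Proof. by move=> FG; apply: (big_ind2 (eqT N)) => //; exact: eqTM. Qed.

(** The derivation T d/dT. *)
Definition fps_euler f : fps R := Fps (fun i => i%:R * fcoef f i).

Lemma fps_eulerM f g : fps_euler (f * g) = fps_euler f * g + f * fps_euler g.
Proof.
apply: fps_eq => i; rewrite fcoefD !fcoefM /= mulr_sumr -big_split /=.
apply: eq_bigr => j _.
have -> : (i%:R = j%:R + (i - j)%:R :> R) by rewrite -natrD subnKC // -ltnS.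
by rewrite mulrDl mulrA; congr (_ + _); rewrite mulrCA.
Qed.

Lemma fps_eulerX f k : fps_euler (f ^+ k.+1) = k.+1%:R * (f ^+ k * fps_euler f).
Proof.
elim: k => [|k IHk]; first by rewrite expr1 expr0 !mul1r.
rewrite exprS fps_eulerM IHk [in RHS]mulrSr mulrDl mul1r addrC.
congr (_ + _); first by rewrite mulrCA [f * (_ * _)]mulrA -exprS.
exact: mulrC.
Qed.

Lemma fcoef_eulerM f g i : fcoef (fps_euler f * g) i.+1 =
  \sum_(k < i.+1) k.+1%:R * fcoef f k.+1 * fcoef g (i - k).
Proof. by rewrite fcoefM big_ord_recl /= !mul0r add0r; apply: eq_bigr. Qed.

Lemma fcoefX0 f k i : fcoef f 0 = 0 -> (i < k)%N -> fcoef (f ^+ k) i = 0.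
Proof.
move=> f0; elim: k i => // k IHk i ik; rewrite exprS fcoefM big1 // => j _.
case: j => -[|j] /= ji; first by rewrite f0 mul0r.
by rewrite IHk ?mulr0 //; lia.
Qed.

End FpsCoef.

Definition map_fps (R S : Type) (phi : R -> S) (f : fps R) : fps S :=
  Fps (fun i => phi (fcoef f i)).

Section MapFps.
Variables (R S : comNzRingType) (phi : {rmorphism R -> S}).

Fact map_fps_zmod : zmod_morphism (map_fps phi).
Proof. by move=> f g; apply: fps_eq => i; rewrite /= rmorphB. Qed.

Fact map_fps_monoid : monoid_morphism (map_fps phi).
Proof.
split=> [|f g]; apply: fps_eq => i; first by rewrite /= rmorph_nat.
by rewrite /= rmorph_sum; apply: eq_bigr => j _; rewrite rmorphM.
Qed.

HB.instance Definition _ :=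
  GRing.isZmodMorphism.Build (fps R) (fps S) (map_fps phi) map_fps_zmod.
HB.instance Definition _ :=
  GRing.isMonoidMorphism.Build (fps R) (fps S) (map_fps phi) map_fps_monoid.

Lemma map_fpsA c : map_fps phi c%:A = (phi c)%:A.
Proof. by apply: fps_eq => i; rewrite /= rmorphM rmorph_nat. Qed.

End MapFps.

Section Binomial.
Variable F : fieldType.
Hypothesis F0 : forall k, (k.+1%:R : F) != 0.

Lemma natF_neq0 k : (0 < k)%N -> (k%:R : F) != 0.
Proof. by case: k => // k _; apply: F0. Qed.

Lemma fps_binomS (a : F) j :
  j.+1%:R * fcoef (fps_binom a) j.+1 = (a - j%:R) * fcoef (fps_binom a) j.
Proof.
rewrite /= big_ord_recr /= factS natrM.
have := F0 j; have := natF_neq0 (fact_gt0 j).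
set x := j.+1%:R; set c := _`!%:R => c0 x0; set y := j%:R; set P := \prod_(i < j) _.
by field; rewrite nat1r F0 natF_neq0 ?fact_gt0.
Qed.

(** The recursion assumed of u and v is the one satisfied by the coefficients
of (1 + T)^a; it is transported to the product by the derivation T d/dT. *)
Lemma convolution_rec (u v : nat -> F) (a b : F) j :
    (forall i, i.+1%:R * u i.+1 = (a - i%:R) * u i) ->
    (forall i, i.+1%:R * v i.+1 = (b - i%:R) * v i) ->
  j.+1%:R * \sum_(i < j.+2) u i * v (j.+1 - i)%N =
  (a + b - j%:R) * \sum_(i < j.+1) u i * v (j - i)%N.
Proof.
move=> uS vS; have := congr1 (fun f => fcoef f j.+1) (fps_eulerM (Fps u) (Fps v)).
rewrite fcoefD !fcoefM [LHS]/= => ->.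
rewrite [X in X + _ = _]big_ord_recl [X in _ + X = _]big_ord_recr /= subnn.
rewrite !mul0r !mulr0 addr0 add0r -big_split mulr_sumr /=.
apply: eq_bigr => i _; rewrite /bump /= add1n subSS uS.
have ij : (i <= j)%N by rewrite -ltnS.
rewrite subSn // vS natrB //; ring.
Qed.

Lemma fps_binomD (a b : F) : fps_binom (a + b) = fps_binom a * fps_binom b.
Proof.
apply: fps_eq; elim=> [|j IHj].
  by rewrite fcoefM big_ord1 /= !big_ord0 fact0 !divr1 mulr1.
apply: (mulfI (F0 j)); rewrite fps_binomS IHj !fcoefM.
by rewrite (convolution_rec j (fps_binomS a) (fps_binomS b)).
Qed.

Lemma fps_binom0 : fps_binom (0 : F) = 1.
Proof.
apply: fps_eq => -[|j]; first by rewrite /= big_ord0 fact0 divr1.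
by rewrite /= big_ord_recl subr0 !mul0r.
Qed.

Lemma fps_binom_sum (I : Type) (s : seq I) (P : pred I) (a : I -> F) :
  fps_binom (\sum_(i <- s | P i) a i) = \prod_(i <- s | P i) fps_binom (a i).
Proof. by apply: (big_morph _ fps_binomD fps_binom0). Qed.

Definition binom_poly j : {poly F} := (j`!%:R)^-1 *: \prod_(i < j) ('X - (i%:R)%:P).

Lemma size_binom_poly j : (size (binom_poly j) <= j.+1)%N.
Proof.
by rewrite (leq_trans (size_scale_leq _ _)) // -big_enum size_prod_XsubC size_enum_ord.
Qed.

Lemma binom_polyE (a : F) j : fcoef (fps_binom a) j = (binom_poly j).[a].
Proof.
rewrite hornerZ horner_prod /= mulrC; congr (_ * _).
by apply: eq_bigr => i _; rewrite hornerXsubC.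
Qed.

(** The coefficient of y^m in (1 + T)^y, that is, log(1 + T)^m / m!. *)
Definition binom_coef m : fps F := Fps (fun j => (binom_poly j)`_m).

Lemma binom_coef_small m j : (j < m)%N -> fcoef (binom_coef m) j = 0.
Proof. by move=> jm; rewrite /= nth_default // (leq_trans (size_binom_poly j)). Qed.

Lemma fps_binom_expand N (a : F) :
  eqT N (fps_binom a) (\sum_(m < N) binom_coef m * (a%:A) ^+ m).
Proof.
move=> j jN; rewrite binom_polyE (@horner_coef_wide _ N); last first.
  by rewrite (leq_trans (size_binom_poly j)).
rewrite fcoef_sum; apply: eq_bigr => m _.
by rewrite exprZn expr1n mulr_algr fcoefZ mulrC.
Qed.

End Binomial.

Lemma map_fps_binom (F E : fieldType) (phi : {rmorphism F -> E}) (a : F) :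
  map_fps phi (fps_binom a) = fps_binom (phi a).
Proof.
apply: fps_eq => j; rewrite /= rmorphM fmorphV rmorph_nat rmorph_prod.
by congr (_ / _); apply: eq_bigr => i _; rewrite rmorphB rmorph_nat.
Qed.

Lemma map_binom_poly (F E : fieldType) (phi : {rmorphism F -> E}) j :
  map_poly phi (binom_poly F j) = binom_poly E j.
Proof.
rewrite map_polyZ fmorphV rmorph_nat rmorph_prod; congr (_ *: _).
by apply: eq_bigr => i _; rewrite rmorphB /= map_polyX map_polyC /= rmorph_nat.
Qed.

Lemma map_binom_coef (F E : fieldType) (phi : {rmorphism F -> E}) m :
  map_fps phi (binom_coef F m) = binom_coef E m.
Proof. by apply: fps_eq => j; rewrite /= -coef_map map_binom_poly. Qed.

Section Exponential.
Variables (F : fieldType) (A : comAlgType F).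
Hypothesis F0 : forall k, (k.+1%:R : F) != 0.

Lemma fps_exp0 (g : fps A) : fcoef (fps_exp g) 0 = 1.
Proof. by rewrite /= big_ord1 fact0 invr1 scale1r. Qed.

(** The differential equation of the exponential, read off coefficientwise.  As
g has no constant term, truncating the exponential sum at different places does
not change the coefficients involved. *)
Lemma fps_expS (g : fps A) i : fcoef g 0 = 0 ->
  i.+1%:R * fcoef (fps_exp g) i.+1 =
  \sum_(k < i.+1) k.+1%:R * fcoef g k.+1 * fcoef (fps_exp g) (i - k).
Proof.
move=> g0; rewrite /= mulr_sumr big_ord_recl expr0 fcoef1 scaler0 mulr0 add0r.
transitivity (\sum_(m < i.+1) (m`!%:R^-1 : F) *: fcoef (fps_euler g * g ^+ m) i.+1).
  apply: eq_bigr => m _; rewrite lift0.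
  rewrite -scalerAr -[_ * fcoef _ _]/(fcoef (fps_euler (g ^+ m.+1)) i.+1) fps_eulerX.
  have -> : m.+1%:R * (g ^+ m * fps_euler g) = (fps_euler g * g ^+ m) *+ m.+1.
    by rewrite mulr_natl [in RHS]mulrC.
  rewrite fcoef_mulr_nat -scaler_nat scalerA factS natrM invfM mulrAC.
  by rewrite mulVf ?mul1r // F0.
transitivity (\sum_(m < i.+1) \sum_(k < i.+1)
    (m`!%:R^-1 : F) *: (k.+1%:R * fcoef g k.+1 * fcoef (g ^+ m) (i - k))).
  by apply: eq_bigr => m _; rewrite -scaler_sumr; congr (_ *: _); exact: fcoef_eulerM.
rewrite exchange_big /=; apply: eq_bigr => k _; rewrite mulr_sumr.
have ki : (k <= i)%N by rewrite -ltnS.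
rewrite (big_ord_widen_cond i.+1 predT
  (fun m => _ * ((m`!%:R^-1 : F) *: fcoef (g ^+ m) (i - k)))) ?ltnS ?leq_subr //.
rewrite [RHS]big_mkcond; apply: eq_bigr => m _.
rewrite -scalerAr; case: ifP => // mk.
by rewrite fcoefX0 ?mulr0 ?scaler0 // ltnNge leqNgt; move/negbT: mk; rewrite andTb ltnS -ltnNge => ->.
Qed.

End Exponential.

(** * Newton's identities for det(1 - X M) *)

Section CharacteristicSeries.
Variables (R : comNzRingType) (k : nat).
Implicit Types (M : 'M[R]_k).

(** Jacobi's formula: differentiating the products in Leibniz' formula gives the
sum over i of the determinants where row i is differentiated, each of which is
expanded along row i. *)
Lemma deriv_det (B : 'M[{poly R}]_k) :
  (\det B)^`() = \tr (map_mx (@deriv R) B *m \adj B).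
Proof.
have derivP (I : eqType) (s : seq I) (F : I -> {poly R}) : uniq s ->
    (\prod_(i <- s) F i)^`() = \sum_(i <- s) (F i)^`() * \prod_(j <- s | j != i) F j.
  elim: s => [|x s IHs]; first by rewrite !big_nil derivC.
  rewrite /= => /andP[xs s_uniq]; rewrite !big_cons derivM IHs // eqxx /=; congr (_ * _ + _).
    rewrite big_seq_cond [RHS]big_seq_cond; apply: eq_bigl => j.
    by case: eqP => [->|]; rewrite ?(negbTE xs) ?andbT.
  rewrite mulr_sumr; apply: eq_big_seq => i si.
  rewrite big_cons ifT; first exact: mulrCA.
  by apply: contraNneq xs => ->.
rewrite /determinant raddf_sum /=.
transitivity (\sum_(i < k) \det (\matrix_(i', j) (if i' == i then (B i' j)^`() else B i' j))).
  under [RHS]eq_bigr do rewrite /determinant.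
  rewrite exchange_big; apply: eq_bigr => s _ /=.
  have sgnC : (-1) ^+ s = ((-1) ^+ s)%:P :> {poly R} by rewrite rmorphXn rmorphN1.
  rewrite derivM sgnC derivC mul0r add0r -mulr_sumr; congr (_ * _).
  rewrite -big_enum derivP ?enum_uniq // big_enum; apply: eq_bigr => i _.
  rewrite [RHS](bigD1 i) //= mxE eqxx big_enum_cond; congr (_ * _).
  by apply: eq_bigr => j /negbTE ji; rewrite mxE ji.
apply: eq_bigr => i _; rewrite (expand_det_row _ i) mxE; apply: eq_bigr => j _.
rewrite !mxE eqxx; congr (_ * _); rewrite /cofactor; congr (_ * \det _).
by apply/matrixP => a b; rewrite !mxE eq_sym (negbTE (neq_lift _ _)).
Qed.

(** The reciprocal of the characteristic polynomial. *)
Definition char_det M : {poly R} := \det (1%:M - 'X *: map_mx polyC M).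

Lemma char_det0 M : (char_det M)`_0 = 1.
Proof.
rewrite -horner_coef0 -[_.[0]]/(horner_eval 0 _) /char_det -det_map_mx.
set B := map_mx _ _; suff -> : B = 1%:M by rewrite det1.
apply/matrixP => i j; rewrite mxE !mxE rmorphB rmorph_nat rmorphM /= [X in X * _]hornerX mul0r.
exact: subr0.
Qed.

(** The traces a_i of M^i adj(1 - X M) satisfy
a_i = det(1 - X M) tr(M^i) + X a_(i+1), and the derivative of the determinant
is - a_1. *)
Lemma char_det_Newton M l :
  l.+1%:R * (char_det M)`_l.+1 = - \sum_(i < l.+1) \tr (M ^+ i.+1) * (char_det M)`_(l - i).
Proof.
set d := char_det M; pose Mp : 'M[{poly R}]_k := map_mx polyC M.
pose B : 'M[{poly R}]_k := 1%:M - 'X *: Mp.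
pose a i := \tr (Mp ^+ i *m \adj B).
have MpX i : Mp ^+ i = map_mx polyC (M ^+ i).
  elim: i => [|i IHi]; first by rewrite !expr0 map_mx1.
  by rewrite !exprS IHi; exact/esym/map_mxM.
have aS i : a i = d * (\tr (M ^+ i))%:P + 'X * a i.+1.
  have adjE : \adj B = d%:M + 'X *: (Mp *m \adj B).
    have -> : d%:M = B *m \adj B by rewrite mul_mx_adj.
    by rewrite mulmxBl mul1mx -scalemxAl subrK.
  rewrite /a [X in \tr (_ *m X) = _]adjE mulmxDr mxtraceD mul_mx_scalar mxtraceZ.
  rewrite -scalemxAr mxtraceZ mulmxA exprSr.
  by have -> : \tr (Mp ^+ i) = (\tr (M ^+ i))%:P by rewrite MpX trace_map_mx.
have coef_a j i : (a i)`_j = \sum_(m < j.+1) \tr (M ^+ (i + m)) * d`_(j - m).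
  elim: j i => [|j IHj] i.
    by rewrite aS coefD coefMC coefXM /= addr0 big_ord1 addn0 mulrC.
  rewrite aS coefD coefMC coefXM /= IHj [RHS]big_ord_recl /= addn0 subn0 [_ * d`_ _]mulrC; congr (_ + _).
  by apply: eq_bigr => m _; rewrite /bump /= add1n subSS addSnnS.
have Dd : d^`() = - a 1.
  rewrite /d /char_det -/B deriv_det /a expr1 -raddfN -mulNmx; congr (\tr (_ *m _)).
  apply/matrixP => i j; rewrite !mxE derivB derivM derivX mul1r derivC mulr0 addr0.
  by rewrite -polyC_natr derivC sub0r.
have := congr1 (fun u : {poly R} => u`_l) Dd; rewrite coef_deriv coefN coef_a => <-.
by rewrite mulr_natl.
Qed.

(** In the product attached to s, each factor contributes either its constant
term, which vanishes unless the index is fixed by s, or its term in X; the set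
J collects the indices of the second kind. *)
Lemma char_det_coef M l : (char_det M)`_l =
  \sum_(s : 'S_k) \sum_(J : {set 'I_k} | (#|J| == l) && [forall i, (i \notin J) ==> (s i == i)])
    (-1) ^+ s * (-1) ^+ l * \prod_(i in J) M i (s i).
Proof.
rewrite /char_det /determinant coef_sum; apply: eq_bigr => s _.
have -> : (-1) ^+ s = ((-1) ^+ s)%:P :> {poly R} by rewrite rmorphXn rmorphN1.
rewrite coefCM.
under eq_bigr => i _ do rewrite !mxE addrC.
rewrite bigA_distr coef_sum.
rewrite mulr_sumr [RHS]big_mkcond; apply: eq_bigr => J _ /=.
have -> : \prod_i (if i \in J then - ('X * (M i (s i))%:P) else (i == s i)%:R) =
   ((-1) ^+ #|J| * \prod_(i in J) M i (s i))%:P * 'X^#|J| *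
    [forall i, (i \notin J) ==> (s i == i)]%:R :> {poly R}.
  rewrite (bigID (mem J)) /=; congr (_ * _).
    rewrite (eq_bigr (fun i => - ('X * (M i (s i))%:P))); last by move=> i ->.
    rewrite prodrN big_split /= prodr_const rmorphM rmorph_prod /= rmorphXn rmorphN1.
    by rewrite -mulrA; congr (_ * _); exact: mulrC.
  under eq_bigr => i iJ do rewrite (negbTE iJ).
  case: forallP => [fix_s|/forallP].
    by rewrite big1 // => i iJ; have := implyP (fix_s i) iJ; rewrite eq_sym => ->.
  rewrite negb_forall => /existsP[i]; rewrite negb_imply => /andP[iJ si].
  by rewrite (bigD1 i) //= eq_sym (negbTE si) mul0r.
case: [forall i, _]; rewrite ?andbF ?andbT ?mulr0 ?mulr1 ?coef0 ?mulr0 //.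
rewrite coefCM coefXn [(#|J| == l)]eq_sym.
by case: eqP => [->|_]; rewrite ?mulr1 ?mulrA // !mulr0.
Qed.

End CharacteristicSeries.

(** * Dwork's congruences for Laurent polynomials *)

Section FormalSums.
Variables (G : zmodType) (A : comNzRingType).
Implicit Types (s t : seq (G * A)) (u v : G * A) (P : G).

(** Laurent polynomials with exponents in G are represented by lists of terms,
with repetitions: only their coefficients and their values are ever used. *)
Definition fs_mul s t := [seq (u.1 + v.1, u.2 * v.2) | u <- s, v <- t].
Definition fs_one : seq (G * A) := [:: (0, 1)].
Definition fs_pow s m := iter m (fs_mul s) fs_one.
Definition fs_scale c s : seq (G * A) := [seq (u.1, c * u.2) | u <- s].
Definition fs_subst e s : seq (G * A) := [seq (u.1 *+ e, u.2) | u <- s].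
Definition fs_coef s P : A := \sum_(u <- s | u.1 == P) u.2.
Definition fs_eval (chi : G -> A) s : A := \sum_(u <- s) u.2 * chi u.1.

Lemma fs_coef_one P : fs_coef fs_one P = (P == 0)%:R.
Proof. by rewrite /fs_coef big_cons big_nil /= eq_sym; case: eqP; rewrite ?addr0. Qed.

Lemma fs_coef_mul s t P :
  fs_coef (fs_mul s t) P = \sum_(v <- t) fs_coef s (P - v.1) * v.2.
Proof.
rewrite /fs_coef big_mkcond big_allpairs_dep exchange_big /=; apply: eq_bigr => v _.
rewrite big_distrl /= [RHS]big_mkcond; apply: eq_bigr => u _.
by rewrite -(subr_eq u.1) opprK.
Qed.

Lemma fs_coef_subst_mul s t e P :
  fs_coef (fs_mul s (fs_subst e t)) P = \sum_(v <- t) fs_coef s (P - v.1 *+ e) * v.2.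
Proof. by rewrite fs_coef_mul big_map. Qed.

Section Eval.
Variable chi : G -> A.
Hypothesis chi0 : chi 0 = 1.
Hypothesis chiD : forall P Q, chi (P + Q) = chi P * chi Q.

Lemma fs_eval_one : fs_eval chi fs_one = 1.
Proof. by rewrite /fs_eval big_seq1 chi0 mulr1. Qed.

Lemma fs_eval_mul s t : fs_eval chi (fs_mul s t) = fs_eval chi s * fs_eval chi t.
Proof.
rewrite /fs_eval big_allpairs_dep big_distrl /=; apply: eq_bigr => u _.
by rewrite big_distrr /=; apply: eq_bigr => v _; rewrite chiD mulrACA.
Qed.

Lemma fs_eval_pow s m : fs_eval chi (fs_pow s m) = fs_eval chi s ^+ m.
Proof.
elim: m => [|m IHm]; first exact: fs_eval_one.
by rewrite /= fs_eval_mul IHm exprS.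
Qed.

Lemma fs_eval_scale c s : fs_eval chi (fs_scale c s) = c * fs_eval chi s.
Proof.
by rewrite /fs_eval big_map big_distrr /=; apply: eq_bigr => u _; rewrite mulrA.
Qed.

Lemma fs_eval_subst e s : fs_eval chi (fs_subst e s) = fs_eval (fun P => chi (P *+ e)) s.
Proof. by rewrite /fs_eval big_map. Qed.

Lemma fs_eval_flatten (I : Type) (r : seq I) (F : I -> seq (G * A)) :
  fs_eval chi (flatten [seq F i | i <- r]) = \sum_(i <- r) fs_eval chi (F i).
Proof. by rewrite /fs_eval big_flatten big_map. Qed.

End Eval.
End FormalSums.

Definition fs_map (G : zmodType) (A B : Type) (phi : A -> B) (s : seq (G * A)) :=
  [seq (u.1, phi u.2) | u <- s].

Lemma fs_coef_map (G : zmodType) (A B : comNzRingType) (phi : {rmorphism A -> B})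
  (s : seq (G * A)) P : fs_coef (fs_map phi s) P = phi (fs_coef s P).
Proof. by rewrite /fs_coef big_map rmorph_sum. Qed.

Lemma fs_mul_map (G : zmodType) (A B : comNzRingType) (phi : {rmorphism A -> B})
  (s t : seq (G * A)) : fs_mul (fs_map phi s) (fs_map phi t) = fs_map phi (fs_mul s t).
Proof.
rewrite /fs_mul /fs_map allpairs_mapl allpairs_mapr map_allpairs /=.
by apply: eq_allpairs => u v; rewrite rmorphM.
Qed.

Lemma fs_pow_map (G : zmodType) (A B : comNzRingType) (phi : {rmorphism A -> B})
  (s : seq (G * A)) m : fs_pow (fs_map phi s) m = fs_map phi (fs_pow s m).
Proof.
elim: m => [|m IHm]; first by rewrite /= /fs_map /= rmorph1.
by rewrite /= IHm fs_mul_map.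
Qed.

Lemma big_neq0 (V : nmodType) (I : eqType) (s : seq I) (P : pred I) (F : I -> V) :
  \sum_(i <- s | P i) F i != 0 -> exists i, [/\ i \in s, P i & F i != 0].
Proof.
move=> nz; suff /hasP[i si /andP[Pi Fi]] : has (fun i => P i && (F i != 0)) s by exists i.
apply: contraNT nz => /hasPn s0; rewrite big_seq_cond big1 // => i /andP[si Pi].
by have := s0 i si; rewrite Pi negbK => /eqP.
Qed.

Section Filtration.
Variables (R : realType) (G : zmodType) (E : comNzRingType).
Local Notation A := (fps E).
Variables (cone : G -> Prop) (wt : {additive G -> R}).
Hypothesis cone0 : cone 0.
Hypothesis coneD : forall P Q, cone P -> cone Q -> cone (P + Q).
Implicit Types s t : seq (G * A).

Lemma coneMn P e : cone P -> cone (P *+ e).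
Proof. by move=> cP; elim: e => // e IHe; rewrite mulrS; apply: coneD. Qed.

(** Off the cone the coefficients vanish and, for kappa > 0, the coefficient of
x^P has T-adic valuation at least the weight of P divided by kappa.  Imposed on
each term, the condition is stable under products of lists. *)
Definition filtered (kappa : R) s := forall u, u \in s ->
  forall l, fcoef u.2 l != 0 -> cone u.1 /\ wt u.1 <= kappa * l%:R.

Lemma filtered_le k k' s : k <= k' -> filtered k s -> filtered k' s.
Proof.
move=> kk' fs u us l ul; have [cu wu] := fs u us l ul; split=> //.
by apply: le_trans wu _; rewrite ler_wpM2r.
Qed.

Lemma filtered_one k : filtered k (fs_one G _).
Proof.
move=> u; rewrite inE => /eqP -> [|l] /=; last by rewrite eqxx.
by rewrite raddf0 mulr0.
Qed.

Lemma fcoefM_neq0 (a b : A) l : fcoef (a * b) l != 0 ->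
  exists i j, [/\ l = (i + j)%N, fcoef a i != 0 & fcoef b j != 0].
Proof.
rewrite fcoefM => /big_neq0[i [_ _ ab]]; exists i, (l - i)%N.
have il : (i <= l)%N by rewrite -ltnS.
by split; [lia|apply: contraNneq ab => ->; rewrite mul0r|apply: contraNneq ab => ->; rewrite mulr0].
Qed.

Lemma filtered_mul k s t : filtered k s -> filtered k t -> filtered k (fs_mul s t).
Proof.
move=> fs ft w /allpairsP[[u v] /= [us vt ->]] l /= /fcoefM_neq0[i [j [-> ui vj]]].
have [cu wu] := fs u us i ui; have [cv wv] := ft v vt j vj.
by split; [exact: coneD|rewrite raddfD natrD mulrDr lerD].
Qed.

Lemma filtered_subst k e s : filtered k s -> filtered (e%:R * k) (fs_subst e s).
Proof.
move=> fs w /mapP[u us ->] l /= ul; have [cu wu] := fs u us l ul.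
split; first exact: coneMn.
by rewrite raddfMn /= -[_ *+ e]mulr_natl -mulrA ler_wpM2l.
Qed.

Lemma filtered_coef k s P l : filtered k s -> fcoef (fs_coef s P) l != 0 ->
  cone P /\ wt P <= k * l%:R.
Proof.
by move=> fs; rewrite fcoef_sum => /big_neq0[u [us /eqP <- ul]]; exact: fs us l ul.
Qed.

(** The m-th power of a polynomial supported in the triangle is supported in its
m-fold dilation. *)
Lemma dilated_pow s m : (forall u, u \in s -> cone u.1 /\ wt u.1 <= 1) ->
  forall u, u \in fs_pow s m -> cone u.1 /\ wt u.1 <= m%:R.
Proof.
move=> s1; elim: m => [|m IHm] u /=.
  by rewrite inE => /eqP -> /=; rewrite raddf0.
case/allpairsP => -[v w] /= [vs ws ->] /=; have [cv wv] := s1 v vs.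
have [cw ww] := IHm w ws; split; first exact: coneD.
by rewrite raddfD mulrS lerD.
Qed.

(** The weights in the m-th power are at most m, which is also a lower bound of
the valuation of [beta m]. *)
Lemma filtered_series N (beta : nat -> A) s :
    (forall m l, (l < m)%N -> fcoef (beta m) l = 0) ->
    (forall u, u \in s -> cone u.1 /\ wt u.1 <= 1) ->
  filtered 1 (flatten [seq fs_scale (beta m) (fs_pow s m) | m <- iota 0 N]).
Proof.
move=> beta0 s1 w /flattenP[t /mapP[m _ ->]] /mapP[u us ->] l /=.
case/fcoefM_neq0 => i [j [-> bi _]]; have [cu wu] := dilated_pow s1 us.
split=> //; apply: le_trans wu _; rewrite mul1r ler_nat.
have : (m <= i)%N by rewrite leqNgt; apply: contraNN bi => /beta0 ->.
by lia.
Qed.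

Section Dwork.
Variables (p : nat) (p_gt1 : (1 < p)%N).
Hypothesis cone_div : forall P e, (0 < e)%N -> cone (P *+ e) -> cone P.
Variable F : nat -> seq (G * A).
Hypothesis F_fil : forall i, filtered 1 (F i).

Fixpoint Frob_prod j : seq (G * A) :=
  if j is j'.+1 then fs_mul (Frob_prod j') (fs_subst (p ^ j') (F j')) else fs_one G _.

(** Substituting x^(p^i) for x multiplies the weights by p^i, and i < j. *)
Lemma filtered_Frob_prod j : filtered (p ^ j.-1)%:R (Frob_prod j).
Proof.
elim: j => [|j IHj]; first exact: filtered_one.
apply: filtered_mul; last by rewrite -[X in filtered X _]mulr1; exact: filtered_subst.
by apply: filtered_le IHj; rewrite ler_nat leq_exp2l // leq_pred.
Qed.

Variables (N : nat) (c : R) (X : seq G) (X_uniq : uniq X).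
Hypothesis XP : forall P, P \in X <-> cone P /\ wt P <= c.
Hypothesis c_large : N%:R <= (p%:R - 1) * c.

(** Here w is the weight of a point beyond the threshold c, and w' that of a
point that is not heavier.  The condition on c is what makes the coefficient at
the corresponding exponent divisible by T^N. *)
Lemma weight_overflow j (w w' : R) l : (l < N)%N -> (0 < j)%N -> 0 <= c -> c < w ->
  w' <= w -> w *+ p ^ j - w' <= (p ^ j.-1)%:R * l%:R -> False.
Proof.
move=> lN j0 c0 cw ww'; set q := (p ^ j.-1)%:R : R.
have -> : w *+ p ^ j = p%:R * q * w.
  by rewrite -[LHS]mulr_natl -{1}(prednK j0) expnS natrM.
have q1 : 1 <= q by rewrite ler1n expn_gt0 ltnW.
have p1 : 1 < (p%:R : R) by rewrite ltr1n.
have lN' : (l%:R : R) + 1 <= N%:R by rewrite natr1 ler_nat.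
move=> h.
have h1 : (p%:R - 1) * w * q <= p%:R * q * w - w'.
  suff : w <= q * w by nra.
  by apply: ler_peMl => //; lra.
have h2 : (p%:R - 1) * w <= l%:R.
  by rewrite -(ler_pM2r (lt_le_trans ltr01 q1)) [_ * q in X in _ <= X]mulrC (le_trans h1).
have h3 : (p%:R - 1) * c < (p%:R - 1) * w by rewrite ltr_pM2l // subr_gt0.
by have := lt_le_trans (le_lt_trans c_large h3) h2; lra.
Qed.

Hypothesis c_ge0 : 0 <= c.

Lemma eqT0P (u : A) : (forall l, (l < N)%N -> fcoef u l != 0 -> False) -> eqT N u 0.
Proof. by move=> u0 l lN; apply/eqP/negPn/negP => /(u0 l lN). Qed.

(** A path that leaves X contributes a multiple of T^N. *)
Lemma Frob_coef_out j P Q : P \in X -> Q \notin X ->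
  eqT N (fs_coef (Frob_prod j) (Q *+ p ^ j - P)) 0.
Proof.
move=> PX QX; case: j => [|j].
  rewrite fs_coef_one; case: eqP => [/eqP|//]; rewrite expn0 mulr1n subr_eq0.
  by move=> /eqP QP; rewrite QP PX in QX.
have [cP wP] := (XP P).1 PX.
apply: eqT0P => l lN /(filtered_coef (@filtered_Frob_prod j.+1)) [cQP wQP].
have cQ : cone Q.
  apply: (@cone_div Q (p ^ j.+1)); first by rewrite expn_gt0 ltnW.
  by rewrite -(subrK P (Q *+ _)); apply: coneD.
have wQ : c < wt Q by rewrite ltNge; apply: contraNN QX => wQ; apply/XP.
rewrite raddfB raddfMn /= in wQP.
exact: (weight_overflow lN (ltn0Sn j) c_ge0 wQ (le_trans wP (ltW wQ)) wQP).
Qed.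

Definition trans_mx i : 'M[A]_(size X) :=
  \matrix_(a, b) fs_coef (F i) (X`_b *+ p - X`_a).

Lemma sum_eq_mem (Y : A) (P : G) (f : G -> G) (fI : injective f) :
  \sum_(a < size X | P == f X`_a) Y = if P \in [seq f x | x <- X] then Y else 0.
Proof.
case: ifP => [/(nthP 0)[k]|PX].
  rewrite size_map => kX DP; rewrite (nth_map 0) // in DP.
  rewrite (big_pred1 (Ordinal kX)) // => a.
  by rewrite -DP (inj_eq fI) nth_uniq //= eq_sym.
rewrite big1 // => a /eqP DP; case/negP: (negbT PX).
by rewrite DP map_f // mem_nth.
Qed.

(** The exponent p^(j+1) Q - P splits as (p^j R - P) + p^j (p Q - R), and summing
over R composes the matrices; by [Frob_coef_out] the points R outside X do not
contribute. *)
Lemma Frob_matrix j a b :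
  eqT N ((\prod_(i < j) trans_mx i) a b) (fs_coef (Frob_prod j) (X`_b *+ p ^ j - X`_a)).
Proof.
elim: j b => [|j IHj] b.
  rewrite big_ord0 mxE fs_coef_one expn0 mulr1n subr_eq0 nth_uniq //.
  by rewrite [X in eqT _ _ (nat_of_bool X)%:R]eq_sym.
rewrite big_ord_recr /= -[_ * _]/(_ *m _) mxE fs_coef_subst_mul.
apply: (@eqT_trans _ _ _ (\sum_(d < size X)
    fs_coef (Frob_prod j) (X`_d *+ p ^ j - X`_a) * trans_mx j d b)).
  by apply: eqT_sum => d _; apply: eqTM => //; exact: IHj.
have -> : \sum_(d < size X) fs_coef (Frob_prod j) (X`_d *+ p ^ j - X`_a) * trans_mx j d b =
    \sum_(v <- F j) \sum_(d < size X | v.1 == X`_b *+ p - X`_d)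
      fs_coef (Frob_prod j) (X`_b *+ p ^ j.+1 - X`_a - v.1 *+ p ^ j) * v.2.
  rewrite [RHS](eq_bigr (fun v => \sum_(d < size X) if v.1 == X`_b *+ p - X`_d then
      fs_coef (Frob_prod j) (X`_b *+ p ^ j.+1 - X`_a - v.1 *+ p ^ j) * v.2 else 0));
    last by move=> v _; rewrite big_mkcond.
  rewrite exchange_big; apply: eq_bigr => d _ /=.
  rewrite mxE /fs_coef mulr_sumr -/(fs_coef _ _) [LHS]big_mkcond; apply: eq_bigr => v _.
  case: eqP => // ->; congr (fs_coef _ _ * _).
  by rewrite mulrnBl -mulrnA -expnS [RHS]addrAC subKr.
apply: eqT_sum => v _.
have fI : injective (fun x : G => X`_b *+ p - x) by move=> x y /addrI/oppr_inj.
rewrite (sum_eq_mem _ _ fI); case: ifP => // /negbT vX.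
set Q := X`_b *+ p - v.1; have DQ : Q \notin X.
  apply: contraNN vX => QX; apply/mapP; exists Q => //.
  by rewrite /Q opprB addrC subrK.
have -> : X`_b *+ p ^ j.+1 - X`_a - v.1 *+ p ^ j = Q *+ p ^ j - X`_a.
  by rewrite /Q mulrnBl -mulrnA -expnS addrAC.
rewrite -[X in eqT N X](mul0r v.2); apply: eqT_sym.
by apply: eqTM => //; apply: Frob_coef_out => //; rewrite mem_nth.
Qed.

(** The exponents retained by d are those of the diagonal entries at j = r; by
[weight_overflow] the ones that come from a point outside X are negligible. *)
Lemma Frob_trace r (d : G -> A) : (0 < r)%N ->
    injective (fun Q : G => Q *+ (p ^ r).-1) ->
    (forall Q, d (Q *+ (p ^ r).-1) = 1) ->
    (forall P, (forall Q, P <> Q *+ (p ^ r).-1) -> d P = 0) ->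
  eqT N (fs_eval d (Frob_prod r)) (\tr (\prod_(i < r) trans_mx i)).
Proof.
move=> r0 mI d1 d0; apply: eqT_sym; rewrite /mxtrace.
have powK : (p ^ r = (p ^ r).-1.+1)%N by rewrite prednK // expn_gt0 ltnW.
apply: (@eqT_trans _ _ _ (\sum_(a < size X) fs_coef (Frob_prod r) (X`_a *+ (p ^ r).-1))).
  apply: eqT_sum => a _; apply: (eqT_trans (@Frob_matrix r a a)).
  by rewrite {1}powK mulrSr addrK.
have -> : \sum_(a < size X) fs_coef (Frob_prod r) (X`_a *+ (p ^ r).-1) =
    \sum_(u <- Frob_prod r) \sum_(a < size X | u.1 == X`_a *+ (p ^ r).-1) u.2.
  rewrite [RHS](eq_bigr (fun u => \sum_(a < size X) if u.1 == X`_a *+ (p ^ r).-1 then u.2 else 0));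
    last by move=> v _; rewrite big_mkcond.
  by rewrite exchange_big; apply: eq_bigr => a _; rewrite /fs_coef big_mkcond.
rewrite /fs_eval; move=> l lN; rewrite !fcoef_sum; apply: eq_big_seq => u us.
rewrite (sum_eq_mem _ _ mI); case: ifP => [/mapP[Q _ ->]|/negbT uX].
  by rewrite d1 mulr1.
have [[Q DQ]|nQ] := pselect (exists Q, u.1 = Q *+ (p ^ r).-1); last first.
  by rewrite d0 ?mulr0 // => Q DQ; apply: nQ; exists Q.
have QX : Q \notin X by apply: contraNN uX => QX; apply/mapP; exists Q.
rewrite DQ d1 mulr1; apply/esym/eqP/negPn/negP => ul.
have [] := filtered_Frob_prod us ul; rewrite DQ => cQ wQ.
have {}cQ : cone Q.
  by apply: cone_div cQ; rewrite -ltnS -powK -[1%N](expn0 p) ltn_exp2l.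
have wQ' : c < wt Q by rewrite ltNge; apply: contraNN QX => wQ'; apply/XP.
apply: (weight_overflow lN r0 c_ge0 wQ' (lexx _)).
have -> : wt Q *+ p ^ r - wt Q = wt Q *+ (p ^ r).-1 by rewrite {1}powK mulrSr addrK.
by move: wQ; rewrite raddfMn.
Qed.

End Dwork.
End Filtration.

(** * Block-cyclic matrices *)

Section BlockCyclic.
Variables (A : comNzRingType) (n D : nat).
Variable M : nat -> 'M[A]_D.
Hypothesis M_per : forall i, M (i + n) = M i.

Lemma per_mod i : M (i %% n)%N = M i.
Proof.
rewrite [in RHS](divn_eq i n) addnC; elim: (i %/ n)%N => [|k IHk]; first by rewrite mul0n addn0.
by rewrite mulSn addnCA addnC M_per.
Qed.

Local Notation J := ('I_n * 'I_D)%type.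

(** A semilinear operator with matrices M i takes this form on the sum of its n
conjugates, which it permutes cyclically. *)
Definition cyclic_mx : 'M[A]_#|{: J}| := \matrix_(x < #|{: J}|, y < #|{: J}|)
  let u : J := enum_val x in let v : J := enum_val y in
  if v.1 == (u.1.+1 %% n)%N :> nat then M u.1 u.2 v.2 else 0.

Lemma cyclic_mxX r (x y : 'I_#|{: J}|) : (cyclic_mx ^+ r) x y =
  let u : J := enum_val x in let v : J := enum_val y in
  if v.1 == ((u.1 + r) %% n)%N :> nat then (\prod_(t < r) M (u.1 + t)) u.2 v.2 else 0.
Proof.
elim: r y => [|r IHr] y.
  rewrite expr0 mxE /= big_ord0 mxE addn0 modn_small // -(inj_eq enum_val_inj).
  case: (enum_val x) (enum_val y) => [i a] [j b] /=.
  by rewrite xpair_eqE -val_eqE /= eq_sym; case: eqP => //= ->; rewrite -val_eqE.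
rewrite exprSr -[_ * _]/(_ *m _) mxE /=.
under eq_bigr => z _ do rewrite IHr mxE /=.
move: (enum_val x : J) (enum_val y : J) => u y'.
rewrite /=; set i := u.1; set a := u.2.
pose G (z : J) := (if z.1 == ((i + r) %% n)%N :> nat then (\prod_(t < r) M (i + t)) a z.2 else 0) *
  (if y'.1 == (z.1.+1 %% n)%N :> nat then M z.1 z.2 y'.2 else 0).
transitivity (\sum_(z : J) G z).
  rewrite (reindex (@enum_val _ (mem {: J}))) /=; last exact: (onW_bij _ (enum_val_bij _)).
  by [].
have n_gt0 : (0 < n)%N by apply: leq_ltn_trans (ltn_ord i).
have im : ((i + r) %% n < n)%N by rewrite ltn_mod.
rewrite (eq_bigr (fun z => G (z.1, z.2))) => [|[]//].
rewrite -(pair_bigA _ (fun j c => G (j, c))) /= (bigD1 (Ordinal im)) //=.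
rewrite [X in _ + X]big1 ?addr0 => [|j /negbTE jm]; last first.
  by rewrite big1 // => c _; rewrite /G /= -[j == _ :> nat]/(j == Ordinal im) jm mul0r.
rewrite /G /= eqxx; have -> : (((i + r) %% n)%N).+1 = (i + r.+1) %[mod n].
  by rewrite -addn1 modnDml addn1 addnS.
case: eqP => _; last by rewrite big1 // => c _; rewrite mulr0.
rewrite big_ord_recr /=.
transitivity (((\prod_(t < r) M (i + t)) *m M (i + r)) a y'.2); last by [].
by rewrite mxE per_mod.
Qed.

Lemma trace_rotate r i : (n %| r)%N ->
  \tr (\prod_(t < r) M (i + t)) = \tr (\prod_(t < r) M t).
Proof.
move=> nr; elim: i => [|i <-]; first by congr (\tr _); apply: eq_bigr.
case: r nr => [|r] nr; first by rewrite !big_ord0.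
rewrite big_ord_recr [in RHS]big_ord_recl /= addn0.
rewrite -[_ * _]/(_ *m _) -[in RHS]/(_ *m _) mxtrace_mulC; congr (\tr (_ *m _)).
  have -> : (i.+1 + r = i + r.+1)%N by rewrite addSnnS.
  by rewrite -per_mod -modnDmr (eqP nr) addn0 per_mod.
by apply: eq_bigr => t _; rewrite addSnnS.
Qed.

Lemma trace_cyclic_mx r : \tr (cyclic_mx ^+ r) =
  if (n %| r)%N then n%:R * \tr (\prod_(t < r) M t) else 0.
Proof.
rewrite /mxtrace; pose G (z : J) := if z.1 == ((z.1 + r) %% n)%N :> nat
  then (\prod_(t < r) M (z.1 + t)) z.2 z.2 else 0.
transitivity (\sum_(z : J) G z).
  rewrite (reindex (@enum_val _ (mem {: J}))) /=; last exact: (onW_bij _ (enum_val_bij _)).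
  by apply: eq_bigr => z _; rewrite cyclic_mxX.
rewrite (eq_bigr (fun z => G (z.1, z.2))) => [|[]//].
rewrite -(pair_bigA _ (fun j c => G (j, c))) /= /G /=.
have fixE (i : 'I_n) : (i == ((i + r) %% n)%N :> nat) = (n %| r)%N.
  by rewrite -{1}(modn_small (ltn_ord i)) -{1}[nat_of_ord i]addn0 eqn_modDl mod0n eq_sym.
under eq_bigr => i _ do under eq_bigr => c _ do rewrite fixE.
case: ifP => nr; last by rewrite big1 // => i _; rewrite big1.
rewrite (eq_bigr (fun=> \tr (\prod_(t < r) M t))); last first.
  by move=> i _; rewrite -(trace_rotate i nr).
by rewrite sumr_const card_ord mulr_natl.
Qed.

End BlockCyclic.

(** * Lower convex hulls *)

Section Hulls.
Variable R : realType.
Local Notation plane := (R^o * R^o)%type.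
Implicit Types (A B : set plane) (P : plane).

Lemma convex_hull_sub A : A `<=` convex_hull A.
Proof. exact: sub_gen_smallest. Qed.

Lemma convex_setP A : (forall x y (t : R), 0 <= t -> t <= 1 -> A x -> A y ->
  A (t *: x + (1 - t) *: y)) -> convex_set (A : set (convex_lmodType plane)).
Proof.
move=> cA x y t /set_mem Ax /set_mem Ay; apply/mem_set.
by apply: cA.
Qed.

Lemma convex_hull_min A B : A `<=` B ->
    (forall x y (t : R), 0 <= t -> t <= 1 -> B x -> B y -> B (t *: x + (1 - t) *: y)) ->
  convex_hull A `<=` B.
Proof. by move=> AB /convex_setP cB; apply: smallest_sub. Qed.

Lemma convex_hull_conv A x y (t : R) : 0 <= t -> t <= 1 ->
  convex_hull A x -> convex_hull A y -> convex_hull A (t *: x + (1 - t) *: y).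
Proof.
move=> t0 t1 Ax Ay B [cB AB]; apply/set_mem.
by apply: (cB x y (Itv01 t0 t1)); apply/mem_set; [apply: Ax|apply: Ay].
Qed.

(** The points that lie above the hull of the first family form a convex set,
which contains the second family. *)
Lemma lower_hull_le (y y' : nat -> \bar R) x :
    (forall i r, y' i = r%:E -> exists2 r', y i = r'%:E & r' <= r) ->
  (lower_hull y x <= lower_hull y' x)%E.
Proof.
move=> yy'; apply: le_ereal_inf_tmp => _ [z xz <-].
pose B : set plane := [set P | exists2 z', z' <= P.2 &
  convex_hull [set P : plane | exists2 i : nat, P.1 = i%:R & P.2%:E = y i] (P.1, z')].
suff [z' z'z xz'] : B (x, z).
  by apply: ge_ereal_inf; exists z'%:E; [exists z'|rewrite lee_fin].
apply: (convex_hull_min _ _ xz) => [P [i P1 P2]|P P' t t0 t1 [a aP hP] [b bP hP']].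
  have [r' yi r'P] := yy' i _ (esym P2); exists r' => //.
  by apply: convex_hull_sub; exists i.
exists (t * a + (1 - t) * b).
  by rewrite /= lerD // ler_wpM2l // subr_ge0.
exact: (convex_hull_conv t0 t1 hP hP').
Qed.

End Hulls.

(** * Permutations of multisets *)

(** The multiset consists of the [pi i] for i in J.  Since s maps J to itself, it
permutes the positions of any enumeration of this multiset. *)
Lemma mset_of_perm_support (I : finType) (T : choiceType) (V : nmodType)
    (pi : I -> T) (s : {perm I}) (J : {set I}) (F : T -> T -> V) :
    (forall i, i \notin J -> s i = i) ->
  exists S : {mset T}%mset, [/\ size S = #|J|, (forall P, P \in S -> exists i, pi i = P),
    (forall P, (S P <= #|[set i | pi i == P]|)%N) &
    exists t : 'S_(size S), \sum_a F (tnth (in_tuple S) (t a)) (tnth (in_tuple S) a) =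
      \sum_(i in J) F (pi (s i)) (pi i)].
Proof.
move=> s_fix; pose S := seq_mset [seq pi i | i in J]; exists S.
have S_perm : perm_eq S [seq pi i | i in J] by apply: perm_eq_seq_mset.
have szS : size S = #|J| by rewrite (perm_size S_perm) size_image.
split=> // [P||].
- by rewrite (perm_mem S_perm) => /mapP[i _ ->]; exists i.
- move=> P; rewrite mset_seqE count_map -size_filter cardE.
  apply: uniq_leq_size; first by rewrite filter_uniq ?enum_uniq.
  by move=> i; rewrite mem_filter => /andP[/= piP _]; rewrite mem_enum inE.
have sJ i : i \in J -> s i \in J.
  move=> iJ; apply: contraLR iJ => siJ; have := s_fix _ siJ.
  by move/perm_inj => si; rewrite -si.
(* An enumeration of J in the order in which S enumerates its elements. *)
have [js js_perm js_S] : exists2 js, perm_eq js (enum J) & map pi js = S.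
  have [i0 _|noI] := pickP (@predT I); last first.
    exists [::]; last first.
      by apply/esym/size0nil; rewrite szS; apply: eq_card0 => i; have := noI i.
    rewrite perm_sym; apply/perm_nilP/size0nil; rewrite -cardE.
    by apply: eq_card0 => i; have := noI i.
  have [Is Is_perm DS] := perm_iotaP (pi i0) S_perm.
  exists [seq nth i0 (enum J) k | k <- Is].
    have {2}-> : enum J = [seq nth i0 (enum J) k | k <- iota 0 (size (enum J))].
      by rewrite map_nth_iota0 // take_size.
    by apply: perm_map; rewrite size_map in Is_perm.
  rewrite DS -map_comp; apply/eq_in_map => k.
  rewrite (perm_mem Is_perm) mem_iota size_map /= add0n => kJ.
  by rewrite (nth_map i0).
have js_uniq : uniq js by rewrite (perm_uniq js_perm) enum_uniq.
have js_mem i : (i \in js) = (i \in J) by rewrite (perm_mem js_perm) mem_enum.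
have js_size : size js = size S by rewrite -js_S size_map.
pose e (a : 'I_(size S)) : I := tnth (in_tuple js) (cast_ord (esym js_size) a).
have e_mem a : e a \in J by rewrite -js_mem mem_tnth.
have eN d (b : 'I_(size S)) : nth d js b = e b by rewrite /e (tnth_nth d).
have e_inj : injective e.
  by move=> a b ab; apply/ord_inj/eqP; rewrite -(nth_uniq (e a) _ _ js_uniq) ?js_size // !eN ab.
have piE a : pi (e a) = tnth (in_tuple S) a.
  have := tnth_nth (pi (e a)) (in_tuple S) a; rewrite /= -[X in nth _ X _]js_S => ->.
  rewrite (nth_map (e a)) ?js_size //; congr (pi _).
  by rewrite eN.
have idxP a : (index (s (e a)) js < size S)%N by rewrite -js_size index_mem js_mem sJ.
pose t0 a : 'I_(size S) := Ordinal (idxP a).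
have eK a : e (t0 a) = s (e a).
  by rewrite /e (tnth_nth (e a)) /= nth_index // js_mem sJ.
have t0_inj : injective t0 by move=> a b /(congr1 e); rewrite !eK => /perm_inj/e_inj.
exists (perm t0_inj).
transitivity (\sum_a F (pi (s (e a))) (pi (e a))).
  by apply: eq_bigr => a _; rewrite permE -!piE eK.
rewrite -[RHS]big_enum -[RHS](perm_big _ js_perm) [RHS]big_tnth.
rewrite (reindex (cast_ord js_size)) /=; last first.
  by exists (cast_ord (esym js_size)) => i _; rewrite ?cast_ordK ?cast_ordKV.
by apply: eq_bigr => a _; rewrite /e cast_ordK.
Qed.

(** * Finite fields and sums over roots of unity *)

Lemma prim_root_closed (p : nat) (p_pr : prime p) (K : closedFieldType)
    (iota : {rmorphism 'F_p -> K}) (r Q : nat) : (0 < r)%N -> Q = (p ^ r)%N ->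
  exists g : K, Q.-1.-primitive_root g.
Proof.
move=> r0 DQ; have Q_gt1 := ppow_gt1 p_pr r0 DQ.
set m := Q.-1; have m0 : (0 < m)%N by rewrite /m -ltnS prednK // ltnW.
have mK : (m%:R : K) != 0.
  have : (m%:R + 1 : K) = 0.
    by rewrite natr1 /m (ppow_predK p_pr r0 DQ) DQ -(prednK r0) expnS natrM (charK_natr p_pr iota) mul0r.
  by apply: contraPneq => ->; rewrite add0r => /eqP; rewrite oner_eq0.
have [rs Drs] := closed_field_poly_normal ('X^m - 1 : {poly K}).
have mon : ('X^m - 1 : {poly K}) \is monic by apply: monicXnsubC.
rewrite (monicP mon) scale1r in Drs.
have rs_uniq : uniq rs by rewrite -separable_prod_XsubC -Drs separable_Xn_sub_1.
have rs_size : size rs = m.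
  by apply/eqP; rewrite -eqSS -(size_prod_XsubC rs id) -Drs size_XnsubC.
have rs_root : all m.-unity_root rs.
  by apply/allP => z zrs; rewrite unity_rootE -subr_eq0; move: zrs;
     rewrite -root_prod_XsubC -Drs => /rootP; rewrite hornerD hornerN hornerXn hornerC => ->.
have /hasP[g _ g_prim] := has_prim_root m0 rs_root rs_uniq (eq_leq (esym rs_size)).
by exists g.
Qed.

(** Multiplication by a nonzero x permutes the q - 1 nonzero elements, whose
product is nonzero; so x^(q-1) = 1. *)
Lemma finite_field_fixed (K : fieldType) (A : set K) (q : nat) :
    A 0 -> A 1 -> (forall x y, A x -> A y -> A (x * y)) -> (A #= `I_q)%card ->
  (1 < q)%N /\ forall x, A x -> x ^+ q = x.
Proof.
move=> A0 A1 AM Aq; have finA : finite_set A by exists q.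
have cardA := card_fset_set Aq.
have memA x : (x \in fset_set A) = (x \in A) by rewrite in_fset_set.
have memA' x : A x -> x \in (fset_set A : seq K) by move=> Ax; rewrite memA; apply/mem_set.
pose s := rem 0 (fset_set A : seq K).
have s_uniq : uniq s by apply: rem_uniq; apply: fset_uniq.
have s_mem x : (x \in s) = (x != 0) && (x \in A).
  by rewrite mem_rem_uniq ?fset_uniq // !inE memA.
have s_size : size s = q.-1 by rewrite size_rem ?memA' // -cardA.
have q1 : (1 < q)%N.
  have : 1 \in s by rewrite s_mem oner_neq0; apply/mem_set.
  by move=> /(@index_mem _ _ _ _)/= || idtac; case: (s) s_size => //= a l; case: (q) => [|[]].
split=> // x Ax; have [->|x0] := eqVneq x 0; first by rewrite expr0n eqn0Ngt ltnW.
have xs_sub : {subset [seq x * y | y <- s] <= s}.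
  move=> _ /mapP[y + ->]; rewrite !s_mem mulf_eq0 negb_or x0 => /andP[-> /set_mem Ay].
  by apply/mem_set/AM.
have xs_uniq : uniq [seq x * y | y <- s] by rewrite map_inj_uniq //; exact: mulfI.
have [_ xs_eq] := uniq_min_size xs_uniq xs_sub (eq_leq (esym (size_map _ _))).
have xs_perm : perm_eq [seq x * y | y <- s] s by apply: uniq_perm.
have s_prod : \prod_(y <- s) y != 0.
  by rewrite prodf_seq_neq0; apply/allP => y; rewrite s_mem => /andP[].
have : \prod_(y <- s) y = x ^+ q.-1 * \prod_(y <- s) y.
  by rewrite -{1}(perm_big _ xs_perm) big_map big_split /= big_const_seq count_predT s_size iter_mulr_1.
rewrite -{1}[\prod_(y <- s) y]mul1r => /(mulIf s_prod) xq.
by rewrite -(prednK (ltnW q1)) exprS -xq mulr1.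
Qed.

Section RootsOfUnity.
Variables (E : fieldType) (M : nat) (zeta : E).
Hypothesis zeta_prim : M.-primitive_root zeta.

Lemma zeta_neq0 : zeta != 0.
Proof. by rewrite (prim_root_eq0 zeta_prim) -lt0n (prim_order_gt0 zeta_prim). Qed.

Lemma zeta_exprz_eq1 (z : int) : zeta ^ z = 1 <-> exists k, z = k *+ M.
Proof.
have M0 := prim_order_gt0 zeta_prim.
have per k : zeta ^ (k *+ M) = 1.
  by rewrite -mulr_natr mulrC -exprz_exp natz -exprnP (prim_expr_order zeta_prim) exp1rz.
split=> [z1|[k ->]//]; exists (z %/ M)%Z.
have : zeta ^ (z %% M)%Z = 1.
  have Dz : z = (z %/ M)%Z *+ M + (z %% M)%Z by rewrite {1}(divz_eq z M) -mulr_natr natz.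
  by move: z1; rewrite {1}Dz expfzDr ?zeta_neq0 // per mul1r.
case Dm : (z %% M)%Z => [m|m]; last first.
  by have := @modz_ge0 z M; rewrite Dm eqz_nat -lt0n M0 => /(_ isT).
move=> zm; have /eqP := zm; rewrite -exprnP -(prim_order_dvd zeta_prim).
have mM : (m < M)%N by have := @ltz_pmod z M; rewrite Dm !ltz_nat M0 => /(_ isT).
rewrite /dvdn modn_small // => /eqP m0.
by rewrite {1}(divz_eq z M) Dm m0 addr0 -mulr_natr natz.
Qed.

Lemma zeta_sum (z : int) :
  \sum_(a < M) (zeta ^ z) ^+ a = if zeta ^ z == 1 then M%:R else 0.
Proof.
case: eqP => [->|/eqP z1].
  by under eq_bigr do rewrite expr1n; rewrite sumr_const card_ord.
have zM : (zeta ^ z) ^+ M = 1.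
  by rewrite exprnP exprz_exp; apply/zeta_exprz_eq1; exists z; rewrite -mulr_natr natz.
have := subrX1 (zeta ^ z) M; rewrite zM subrr => /esym/eqP.
by rewrite mulf_eq0 subr_eq0 (negbTE z1) => /eqP.
Qed.

Local Notation G := (int * int)%type.

Definition zeta_char (a b : nat) (P : G) : E := (zeta ^ P.1) ^+ a * (zeta ^ P.2) ^+ b.

Lemma zeta_char0 a b : zeta_char a b 0 = 1.
Proof. by rewrite /zeta_char /= !expr0z !expr1n mulr1. Qed.

Lemma zeta_charD a b P Q : zeta_char a b (P + Q) = zeta_char a b P * zeta_char a b Q.
Proof. by rewrite /zeta_char /= !expfzDr ?zeta_neq0 // !exprMn mulrACA. Qed.

Definition lattice_ind (P : G) : E := `[< exists Q, P = Q *+ M >]%:R.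

(** Orthogonality of characters, in each coordinate. *)
Lemma zeta_char_sum P :
  \sum_(a < M) \sum_(b < M) zeta_char a b P = (M ^ 2)%:R * lattice_ind P.
Proof.
under eq_bigr do rewrite -mulr_sumr zeta_sum.
rewrite -mulr_suml zeta_sum /lattice_ind.
have pair_mulrn (Q : G) k : Q *+ k = (Q.1 *+ k, Q.2 *+ k).
  by elim: k => [|k IHk]; rewrite ?mulr0n // !mulrS IHk.
case: asboolP => [[Q ->]|nP].
  have zQ k : zeta ^ (k *+ M) == 1 by apply/eqP/zeta_exprz_eq1; exists k.
  by rewrite pair_mulrn /= !zQ mulr1 natrX.
rewrite mulr0; case: eqP => [/zeta_exprz_eq1[k1 P1]|]; last by rewrite mul0r.
case: eqP => [/zeta_exprz_eq1[k2 P2]|]; last by rewrite mulr0.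
by case: nP; exists (k1, k2); rewrite pair_mulrn [P]surjective_pairing P1 P2.
Qed.

End RootsOfUnity.

(** * The exponential sum as a trace modulo T^N *)

Section ExponentialSum.
Variables (p : nat) (p_pr : prime p) (K : fieldType) (iota : {rmorphism 'F_p -> K}).
Variables (r : nat) (r_gt0 : (0 < r)%N).
Variables (Q : nat) (DQ : Q = (p ^ r)%N).
Variables (g : K) (g_prim : Q.-1.-primitive_root g).
Variable L : unramified_ext p_pr K Q.
Variable f : mpoly 2 K.
Hypothesis f_fixed : forall m, mcoeff m f ^+ Q = mcoeff m f.
Local Notation tau := (teichmuller L).
Local Notation G := (int * int)%type.
Local Notation M := Q.-1.

Definition exponent (m : multinom 2) : G := ((m ord0)%:Z, (m ord_max)%:Z).

Definition teich_terms j : seq (G * fps L) :=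
  [seq (exponent m, (tau (mcoeff m f) ^+ (p ^ j))%:A) | m <- msupp f].

(** The series (1 + T)^f modulo T^N, where f has the p^j-th powers of the
Teichmueller lifts as coefficients. *)
Definition splitting N j : seq (G * fps L) :=
  flatten [seq fs_scale (binom_coef L i) (fs_pow (teich_terms j) i) | i <- seq.iota 0 N].

Lemma lift_valueE (x : K * K) : lift_value L f x =
  \sum_(m <- msupp f) tau (mcoeff m f) * (tau x.1 ^+ m ord0 * tau x.2 ^+ m ord_max).
Proof.
rewrite /lift_value /map_mpoly /mmap raddf_sum; apply: eq_bigr => m _ /=.
rewrite mevalM mevalC /mmap1 rmorph_prod /= big_ord_recl big_ord1.
have -> : lift ord0 ord0 = ord_max :> 'I_2 by exact: val_inj.
congr (_ * (_ * _)).
  by rewrite rmorphXn /= mevalXU.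
by rewrite rmorphXn /= mevalXU.
Qed.

Lemma exp_sum_expand : exp_sum L f = \sum_(a < M) \sum_(b < M)
  fps_binom (field_trace (lift_value L f (g ^+ a, g ^+ b))).
Proof.
rewrite pair_bigA /=; pose h (ab : 'I_M * 'I_M) := (g ^+ ab.1, g ^+ ab.2).
transitivity (\sum_(ab \in [set: 'I_M * 'I_M])
    fps_binom (field_trace (lift_value L f (h ab)))); last first.
  rewrite -[RHS]big_enum [RHS]fsbig_seq ?enum_uniq //; apply: eq_fsbigl.
  by apply/seteqP; split=> // ab _; rewrite /= mem_enum.
apply: (reindex_fsbig h setT _ (fun x => fps_binom (field_trace (lift_value L f x)))).
split=> [ab _|ab ab' _ _|[x y] [[xQ x0] [yQ y0]]].
- have gk k : @finite_units K Q (g ^+ k).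
    split; first exact: (finite_subfield_exp p_pr r_gt0 DQ g_prim).
    by move=> /eqP; rewrite expf_eq0 (negbTE (primitive_root_neq0 p_pr r_gt0 DQ g_prim)) andbF.
  by split; apply: gk.
- case: ab ab' => [a b] [a' b'] [] /eqP + /eqP.
  rewrite !(eq_prim_root_expr g_prim) !modn_small // => /eqP aa' /eqP bb'.
  by congr pair; apply: ord_inj.
- have gE z : @finite_subfield K Q z -> z <> 0 -> exists k : 'I_M, z = g ^+ k.
    move=> zQ z0; have [//|[k kM ->]] := finite_subfieldP p_pr r_gt0 DQ g_prim zQ.
    by exists (Ordinal kM).
  by have [[k ->] [l ->]] := (gE x xQ x0, gE y yQ y0); exists (k, l).
Qed.

Lemma alg_morph (E : fieldType) (x y : E) : (x * y)%:A = x%:A * y%:A :> fps E.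
Proof. by rewrite -scalerAl mul1r scalerA. Qed.

(** The trace is the sum of the conjugates, and (1 + T)^a turns sums into
products. *)
Lemma exp_sum_term N (a b : nat) :
  eqT N (map_fps (in_alg L) (fps_binom (field_trace (lift_value L f (g ^+ a, g ^+ b)))))
   (fs_eval (fun P => (zeta_char (tau g) a b P)%:A) (Frob_prod p (splitting N) r)).
Proof.
have /choice[sigma sigmaP] := fun j => Frobenius_exists iota r_gt0 DQ g_prim L j.
have gQ : g ^+ Q = g by have := finite_subfield_exp p_pr r_gt0 DQ g_prim 1; rewrite expr1.
have L0 k : (k.+1%:R : L) != 0 by apply: ur_natr_neq0.
have zeta_prim := teich_prim iota r_gt0 DQ g_prim L.
set chi := fun P => _.
have chi0 : chi 0 = 1 by rewrite /chi zeta_char0 scale1r.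
have chiD P P' : chi (P + P') = chi P * chi P'.
  by rewrite /chi (zeta_charD zeta_prim) alg_morph.
set y := lift_value _ _ _.
have evP j : fs_eval chi (Frob_prod p (splitting N) j) =
    \prod_(i < j) fs_eval (fun P => chi (P *+ p ^ i)) (splitting N i).
  elim: j => [|j IHj]; first by rewrite big_ord0 (fs_eval_one chi0).
  rewrite big_ord_recr -IHj [Frob_prod _ _ _.+1]/= (fs_eval_mul chiD) (fs_eval_subst chi).
  exact: erefl.
rewrite evP map_fps_binom /=.
rewrite (@trace_conjugates p p_pr K iota r r_gt0 Q DQ g g_prim L (fun j : 'I_r => sigma j)).
- rewrite (fps_binom_sum L0); apply: eqT_prod => j _.
  have chij0 : chi (0 *+ p ^ j) = 1 by rewrite mul0rn.
  have chijD P P' : chi ((P + P') *+ p ^ j) = chi (P *+ p ^ j) * chi (P' *+ p ^ j).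
    by rewrite mulrnDl.
  suff -> : fs_eval (fun P => chi (P *+ p ^ j)) (splitting N j) =
      \sum_(i < N) binom_coef L i * (sigma j y)%:A ^+ i by exact: fps_binom_expand.
  rewrite /splitting fs_eval_flatten -{1}[N]subn0 -/(index_iota 0 N) big_mkord.
  apply: eq_bigr => i _; rewrite fs_eval_scale (fs_eval_pow chij0 chijD); congr (_ * _ ^+ _).
  rewrite /fs_eval big_map /y lift_valueE rmorph_sum scaler_suml; apply: eq_bigr => m _ /=.
  rewrite /chi -alg_morph; congr (_ *: 1).
  have [_ sig_tau] := sigmaP j.
  rewrite !rmorphM !rmorphXn /= !sig_tau // ?(finite_subfield_exp p_pr r_gt0 DQ g_prim) //.
  rewrite !(teichX iota r_gt0 DQ g_prim L _ gQ); congr (_ * _).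
  have exponentE k : exponent m *+ k = ((m ord0 * k)%N%:Z, (m ord_max * k)%N%:Z).
    by elim: k => [|k IHk]; rewrite ?muln0 // mulrS IHk !mulnS.
  rewrite exponentE /zeta_char /=.
  by congr (_ * _); rewrite -exprnP -!exprM; congr (_ ^+ _); lia.
- by move=> j a'; have [] := sigmaP j.
- move=> j; have [_ ->//] := sigmaP j.
Qed.

(** Dwork's trace formula modulo T^N: summing [exp_sum_term] over x retains the
exponents divisible by Q - 1, which [Frob_trace] turns into a trace. *)
Lemma exp_sum_trace (R : realType) (cone : G -> Prop) (wt : {additive G -> R})
    (N : nat) (c : R) (X : seq G) :
    cone 0 -> (forall P P', cone P -> cone P' -> cone (P + P')) ->
    (forall P e, (0 < e)%N -> cone (P *+ e) -> cone P) ->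
    (forall m, m \in msupp f -> cone (exponent m) /\ wt (exponent m) <= 1) ->
    uniq X -> (forall P, P \in X <-> cone P /\ wt P <= c) ->
    N%:R <= (p%:R - 1) * c -> 0 <= c ->
  eqT N (map_fps (in_alg L) (exp_sum L f))
    ((M ^ 2)%:R * \tr (\prod_(i < r) trans_mx p (splitting N) X i)).
Proof.
move=> cone0 coneD cone_div f_supp X_uniq XP c_large c_ge0.
have zeta_prim := teich_prim iota r_gt0 DQ g_prim L.
have F_fil i : filtered cone wt 1 (splitting N i).
  apply: filtered_series => //; first exact: binom_coef_small.
  by move=> u /mapP[m fm ->]; exact: f_supp.
have M0 : (0 < M)%N := prim_order_gt0 zeta_prim.
have mulrnI : injective (fun P : G => P *+ (p ^ r).-1).
  have mulrnE (P : G) k : P *+ k = (P.1 *+ k, P.2 *+ k).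
    by elim: k => [|k IHk]; rewrite ?mulr0n // !mulrS IHk.
  move=> P P'; rewrite -DQ !mulrnE => -[/eqP + /eqP].
  rewrite !eqr_pMn2r // => /eqP P1 /eqP P2.
  by rewrite [P]surjective_pairing P1 P2 -surjective_pairing.
pose d P : fps L := (lattice_ind L M P)%:A.
have tr_d : eqT N (fs_eval d (Frob_prod p (splitting N) r))
    (\tr (\prod_(i < r) trans_mx p (splitting N) X i)).
  apply: (@Frob_trace R G L cone wt cone0 coneD p (prime_gt1 p_pr) cone_div (splitting N) F_fil
    N c X X_uniq XP c_large c_ge0 r d r_gt0 mulrnI).
    by move=> P; rewrite /d /lattice_ind asboolT ?scale1r // -DQ; exists P.
  move=> P nP; rewrite /d /lattice_ind asboolF ?scale0r // => -[P' DP].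
  by apply: (nP P'); rewrite -DQ.
apply: eqT_trans (eqTM (@eqT_refl _ N (M ^ 2)%:R) tr_d).
rewrite exp_sum_expand rmorph_sum /=.
apply: (@eqT_trans _ _ _ (\sum_(a < M) \sum_(b < M)
    fs_eval (fun P => (zeta_char (tau g) a b P)%:A) (Frob_prod p (splitting N) r))).
  apply: eqT_sum => a _; rewrite rmorph_sum /=; apply: eqT_sum => b _.
  exact: exp_sum_term.
suff -> : \sum_(a < M) \sum_(b < M)
    fs_eval (fun P => (zeta_char (tau g) a b P)%:A) (Frob_prod p (splitting N) r) =
    (M ^ 2)%:R * fs_eval d (Frob_prod p (splitting N) r) by [].
rewrite pair_bigA /fs_eval exchange_big mulr_sumr; apply: eq_bigr => u _ /=.
rewrite -mulr_sumr mulrCA; congr (_ * _).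
rewrite -(pair_bigA _ (fun a b : 'I_M => (zeta_char (tau g) a b u.1)%:A)) /=.
rewrite /d -(rmorph_nat (in_alg (fps L))) /= -alg_morph -(zeta_char_sum zeta_prim) scaler_suml.
by apply: eq_bigr => a _; rewrite scaler_suml.
Qed.

End ExponentialSum.

(** * The cone of a triangle *)

Section TriangleCone.
Variables (R : realType).
Local Notation plane := (R^o * R^o)%type.
Variables (P1 P2 : plane) (w : {scalar plane}).
Hypothesis w_line : forall t : R, w ((1 - t) *: P1 + t *: P2) = 1.
Local Notation D := (convex_hull [set (0, 0); P1; P2] : set plane).
Local Notation G := (int * int)%type.
Local Notation cone := (cone_lattice D).

Lemma w_vertex1 : w P1 = 1.
Proof. by have := w_line 0; rewrite subr0 scale1r scale0r addr0. Qed.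

Lemma w_vertex2 : w P2 = 1.
Proof. by have := w_line 1; rewrite subrr scale1r scale0r add0r. Qed.

Lemma triangleP (x : plane) : D x <->
  exists a b : R, [/\ 0 <= a, 0 <= b, a + b <= 1 & x = a *: P1 + b *: P2].
Proof.
split.
  apply: (@convex_hull_min R _ [set x | exists a b : R,
    [/\ 0 <= a, 0 <= b, a + b <= 1 & x = a *: P1 + b *: P2]]).
    move=> y [[->|->]|->].
    - by exists 0, 0; rewrite !scale0r !addr0 lexx ler01.
    - by exists 1, 0; rewrite scale0r scale1r !addr0 lexx ler01.
    - by exists 0, 1; rewrite scale0r scale1r !add0r lexx ler01.
  move=> y z t t0 t1 [a [b [a0 b0 ab ->]]] [a' [b' [a'0 b'0 ab' ->]]].
  exists (t * a + (1 - t) * a'), (t * b + (1 - t) * b').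
  have t1' : 0 <= 1 - t by rewrite subr_ge0.
  split; first by rewrite addr_ge0 ?mulr_ge0.
  - by rewrite addr_ge0 ?mulr_ge0.
  - nra.
  - by rewrite !scalerDr !scalerA !scalerDl addrACA.
case=> a [b [a0 b0 ab ->]].
have D0 : D 0 by apply: convex_hull_sub; left; left.
have DP1 : D P1 by apply: convex_hull_sub; left; right.
have DP2 : D P2 by apply: convex_hull_sub; right.
have [s0|s0] := eqVneq (a + b) 0.
  have [-> ->] : a = 0 /\ b = 0 by split; lra.
  by rewrite !scale0r addr0.
have s_gt0 : 0 < a + b by rewrite lt_neqAle eq_sym s0 addr_ge0.
have Dy : D ((a / (a + b)) *: P1 + (1 - a / (a + b)) *: P2).
  apply: convex_hull_conv => //; first by rewrite divr_ge0 // ltW.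
  by rewrite ler_pdivrMr // mul1r lerDl.
have := convex_hull_conv (ltW s_gt0) ab Dy D0; rewrite scaler0 addr0 scalerDr !scalerA.
have -> : (a + b) * (a / (a + b)) = a by rewrite mulrCA divff ?mulr1.
have -> // : (a + b) * (1 - a / (a + b)) = b.
by rewrite mulrBr mulr1 mulrCA divff // mulr1 addrC addKr.
Qed.

Lemma coneP (P : G) : cone P <->
  exists a b : R, [/\ 0 <= a, 0 <= b & lattice_pt R P = a *: P1 + b *: P2].
Proof.
split=> [[k k0 /triangleP[a [b [a0 b0 ab DP]]]]|[a [b [a0 b0 DP]]]].
  exists (k^-1 * a), (k^-1 * b); split; try by rewrite mulr_ge0 // invr_ge0 ltW.
  by rewrite -!scalerA -scalerDr -DP scalerA mulVf ?scale1r // gt_eqF.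
have s0 : 0 < (a + b + 1) by lra.
exists (a + b + 1)^-1; first by rewrite invr_gt0.
apply/triangleP; exists ((a + b + 1)^-1 * a), ((a + b + 1)^-1 * b).
have i0 : 0 <= (a + b + 1)^-1 by rewrite invr_ge0 ltW.
split; try by rewrite mulr_ge0.
  by rewrite -mulrDr mulrC ler_pdivrMr // mul1r lerDl.
by rewrite DP scalerDr !scalerA.
Qed.

Fact lattice_pt_zmod : zmod_morphism (@lattice_pt R).
Proof. by move=> P P'; rewrite /lattice_pt /= !intrB. Qed.

HB.instance Definition _ :=
  GRing.isZmodMorphism.Build (int * int)%type plane (@lattice_pt R) lattice_pt_zmod.

Lemma cone_0 : cone 0.
Proof.
by apply/coneP; exists 0, 0; rewrite raddf0 !scale0r addr0.
Qed.

Lemma cone_add P P' : cone P -> cone P' -> cone (P + P').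
Proof.
move=> /coneP[a [b [a0 b0 DP]]] /coneP[a' [b' [a'0 b'0 DP']]]; apply/coneP.
exists (a + a'), (b + b'); rewrite !addr_ge0 // raddfD /= DP DP' !scalerDl.
by split=> //; rewrite addrACA.
Qed.

Lemma cone_divn P e : (0 < e)%N -> cone (P *+ e) -> cone P.
Proof.
move=> e0 [k k0 Dk]; exists (k * e%:R); first by rewrite mulr_gt0 ?ltr0n.
by move: Dk; rewrite raddfMn /= -scaler_nat scalerA.
Qed.

Definition lattice_wt (P : G) : R := w (lattice_pt R P).

Fact lattice_wt_zmod : zmod_morphism lattice_wt.
Proof. by move=> P P'; rewrite /lattice_wt !raddfB. Qed.

HB.instance Definition _ :=
  GRing.isZmodMorphism.Build G R lattice_wt lattice_wt_zmod.

Lemma w_comb a b : w (a *: P1 + b *: P2) = a + b.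
Proof. by rewrite linearD !linearZ /= w_vertex1 w_vertex2 !mulr1. Qed.

Lemma cone_wt_ge0 P : cone P -> 0 <= lattice_wt P.
Proof.
by move=> /coneP[a [b [a0 b0 DP]]]; rewrite /lattice_wt DP w_comb addr_ge0.
Qed.

Lemma triangle_lattice P : D (lattice_pt R P) -> cone P /\ lattice_wt P <= 1.
Proof.
move=> DP; split; first by exists 1; rewrite ?ltr01 ?scale1r.
by have /triangleP[a [b [_ _ ab]]] := DP; rewrite /lattice_wt => ->; rewrite w_comb.
Qed.

(** A point a P1 + b P2 of the cone has weight a + b, which bounds its
coordinates. *)
Lemma cone_bounded (c : R) : exists X : seq G, uniq X /\
  forall P, P \in X <-> cone P /\ lattice_wt P <= c.
Proof.
pose B := `|P1.1| + `|P2.1| + `|P1.2| + `|P2.2|; pose m := Num.bound (c * B).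
pose box : seq G := [seq ((i%:Z - m%:Z), (j%:Z - m%:Z)) |
  i <- seq.iota 0 (m + m).+1, j <- seq.iota 0 (m + m).+1].
exists (undup [seq P <- box | `[< cone P /\ lattice_wt P <= c >]]); split; first exact: undup_uniq.
move=> P; rewrite mem_undup mem_filter; split=> [/andP[/asboolP]//|cP].
apply/andP; split; first exact/asboolP.
case: cP => /coneP[a [b [a0 b0 DP]]]; rewrite /lattice_wt DP w_comb => abc.
have bound_int (x y : R) (z : int) : `|x| + `|y| <= B -> z%:~R = a * x + b * y ->
    exists2 i, (i < (m + m).+1)%N & z = i%:Z - m%:Z.
  move=> xy Dz.
  have zm : `|z| <= m%:Z.
    rewrite -(ler_int R) intr_norm Dz.
    apply: le_trans (ltW (archi_boundP _)); last first.
      by rewrite mulr_ge0 ?addr_ge0 // (le_trans _ abc) // addr_ge0.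
    apply: (le_trans (ler_normD _ _)); rewrite !normrM (ger0_norm a0) (ger0_norm b0).
    have := normr_ge0 x; have := normr_ge0 y; nra.
  by exists (absz (z + m%:Z)); lia.
have DP' := DP; case: DP => D1 D2.
have xB : `|P1.1| + `|P2.1| <= B by rewrite /B -addrA lerDl addr_ge0.
have yB : `|P1.2| + `|P2.2| <= B by rewrite /B -addrA lerDr addr_ge0.
have [i iP Di] := bound_int P1.1 P2.1 P.1 xB D1.
have [j jP Dj] := bound_int P1.2 P2.2 P.2 yB D2.
by apply/allpairsP; exists (i, j); rewrite !mem_iota /= -Di -Dj -surjective_pairing.
Qed.

End TriangleCone.

(** * Coefficients of the characteristic series *)

Section SeriesComparison.
Variables (E : fieldType).
Hypothesis E0 : forall k, (k.+1%:R : E) != 0.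

Lemma fcoef_natM k (u : fps E) i : fcoef (k%:R * u) i = k%:R * fcoef u i.
Proof. by rewrite !mulr_natl fcoef_mulr_nat. Qed.

Lemma eqT_natM N k (u v : fps E) : (0 < k)%N -> eqT N (k%:R * u) (k%:R * v) -> eqT N u v.
Proof.
case: k => // k _ uv i iN; have := uv i iN.
by rewrite !fcoef_natM => /(mulfI (E0 k)).
Qed.

Lemma sum_multiples (V : nmodType) (n i : nat) (F : nat -> V) : (0 < n)%N ->
    (forall j, ~~ (n %| j.+1)%N -> F j = 0) ->
  \sum_(j < n * i) F j = \sum_(k < i) F (n * k.+1).-1.
Proof.
case: n => // n _ F0; elim: i => [|i IHi]; first by rewrite muln0 !big_ord0.
rewrite mulnSr -(big_mkord predT F) (@big_cat_nat _ _ _ (n.+1 * i)) ?leq_addr //= big_mkord IHi.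
rewrite [RHS]big_ord_recr /=; congr (_ + _).
rewrite -{1}[(n.+1 * i)%N]add0n big_addn addKn big_nat_recr //= big_nat big1 => [|j /andP[_ jn]].
  by rewrite add0r; congr F; lia.
by apply: F0; rewrite -addSn dvdn_addl ?dvdn_mulr // gtnNdvd.
Qed.

(** Both sides satisfy the same recursion, once the terms with vanishing trace are
discarded from Newton's identities and the common factor n is cancelled. *)
Lemma series_compare (n N K : nat) (Z : 'M[fps E]_K) (t c : nat -> fps E) : (0 < n)%N ->
    (forall r, (0 < r)%N -> eqT N (\tr (Z ^+ r))
       (if (n %| r)%N then n%:R * t (r %/ n)%N else 0)) ->
    c 0%N = 1 ->
    (forall i, i.+1%:R * c i.+1 = - \sum_(k < i.+1) t k.+1 * c (i - k)%N) ->
  forall i, eqT N (char_det Z)`_(n * i) (c i).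
Proof.
move=> n0 trZ c0 cS i; have [m] := ubnP i; elim: m i => // m IHm [|i] im.
  by rewrite muln0 char_det0 c0.
apply: (@eqT_natM _ (n * i.+1)); first by rewrite muln_gt0 n0.
have Dn : (n * i.+1 = (n * i.+1).-1.+1)%N by rewrite prednK // muln_gt0 n0.
rewrite {1 2}Dn char_det_Newton -Dn natrM -mulrA cS mulrN mulr_sumr.
apply: eqTN.
pose F j : fps E := (if (n %| j.+1)%N then n%:R * t (j.+1 %/ n)%N else 0) *
  (char_det Z)`_((n * i.+1).-1 - j).
apply: (@eqT_trans _ _ _ (\sum_(j < n * i.+1) F j)).
  by apply: eqT_sum => j _; apply: eqTM => //; apply: trZ.
rewrite sum_multiples //; last by move=> j /negbTE nj; rewrite /F nj mul0r.
apply: eqT_sum => k _; rewrite /F prednK ?muln_gt0 ?n0 // dvdn_mulr // mulKn // mulrA.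
apply: eqTM => //.
have -> : ((n * i.+1).-1 - (n * k.+1).-1 = n * (i - k))%N by have := ltn_ord k; nia.
by apply: IHm; have := ltn_ord k; lia.
Qed.

Lemma prod_valuation (I : finType) (J : {set I}) (a : I -> fps E) (c : I -> int) j :
    (forall i l, fcoef (a i) l != 0 -> c i <= l%:Z) ->
  fcoef (\prod_(i in J) a i) j != 0 -> \sum_(i in J) c i <= j%:Z.
Proof.
move=> ac; elim/big_rec2: _ j => [|i y1 y2 _ IH] j //.
by case/fcoefM_neq0 => l [l' [-> al yl]]; rewrite PoszD lerD ?ac ?IH.
Qed.

Lemma char_det_coef_neq0 (K l j : nat) (Z : 'M[fps E]_K) (c : 'I_K -> 'I_K -> int) :
    (forall x y k, fcoef (Z x y) k != 0 -> c x y <= k%:Z) ->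
    fcoef (char_det Z)`_l j != 0 ->
  exists (s : 'S_K) (J : {set 'I_K}), [/\ #|J| = l, forall i, i \notin J -> s i = i &
    \sum_(i in J) c i (s i) <= j%:Z].
Proof.
move=> cZ; rewrite char_det_coef fcoef_sum => /big_neq0[s [_ _]].
rewrite fcoef_sum => /big_neq0[J [_ /andP[/eqP Jl /forallP s_fix] nz]].
exists s, J; split=> // [i iJ|]; first by apply/eqP; exact: (implyP (s_fix i) iJ).
apply: (prod_valuation (a := fun i => Z i (s i))) => [i k|]; first exact: cZ.
apply: contraNneq nz => nz; rewrite -exprD; case: (boolP (odd (s + l))) => _;
  rewrite -signr_odd; case: (odd _); rewrite ?expr1 ?expr0 ?mulN1r ?mul1r ?fcoefN nz ?oppr0 //.
Qed.

End SeriesComparison.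

(** * The points of the Newton polygon *)

Lemma splitting_map (p : nat) (p_pr : prime p) (K : fieldType) (Q Q' : nat)
    (L : unramified_ext p_pr K Q) (L' : unramified_ext p_pr K Q') (f : mpoly 2 K)
    (phi : {rmorphism L -> L'}) N i :
    (forall m, phi (teichmuller L (mcoeff m f)) = teichmuller L' (mcoeff m f)) ->
  splitting L' f N i = fs_map (map_fps phi) (splitting L f N i).
Proof.
move=> phi_t; rewrite /splitting /fs_map map_flatten -map_comp; congr flatten.
apply: eq_map => k /=; rewrite -/(fs_map (map_fps phi) _).
have -> : teich_terms L' f i = fs_map (map_fps phi) (teich_terms L f i).
  rewrite /teich_terms /fs_map -[RHS]map_comp; apply: eq_map => m /=.
  by rewrite map_fpsA rmorphXn phi_t.
rewrite fs_pow_map /fs_scale /fs_map -!map_comp; apply: eq_map => u /=.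
by rewrite rmorphM /= map_binom_coef.
Qed.

Lemma trans_mx_map (G : zmodType) (A B : comNzRingType) (phi : {rmorphism A -> B})
    p (F : nat -> seq (G * fps A)) (F' : nat -> seq (G * fps B)) X i :
    (forall i, F' i = fs_map (map_fps phi) (F i)) ->
  trans_mx p F' X i = map_mx (map_fps phi) (trans_mx p F X i).
Proof. by move=> FF'; apply/matrixP => a b; rewrite !mxE FF' fs_coef_map. Qed.

Lemma trace_prod_map (A B : comNzRingType) (phi : {rmorphism A -> B}) D r
    (M : nat -> 'M[A]_D) (M' : nat -> 'M[B]_D) :
    (forall i, M' i = map_mx phi (M i)) ->
  \tr (\prod_(i < r) M' i) = phi (\tr (\prod_(i < r) M i)).
Proof.
move=> MM'; rewrite -trace_map_mx; congr (\tr _).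
elim: r => [|r IHr]; first by rewrite !big_ord0 map_mx1.
by rewrite !big_ord_recr /= IHr MM'; exact/esym/map_mxM.
Qed.

Lemma min_cost_le (R : realType) (p : nat) (w : {scalar (R^o * R^o)%type})
  (S : {mset int * int}%mset) (t : 'S_(size S)) : min_cost p w S <= perm_cost p w t.
Proof. exact: bigmin_le. Qed.

(** Without the ceilings, the cost of any permutation is p - 1 times the total
weight. *)
Lemma min_cost_ge0 (R : realType) (p : nat) (w : {scalar (R^o * R^o)%type})
    (S : {mset int * int}%mset) : (0 < p)%N ->
    (forall P, P \in S -> 0 <= w (lattice_pt R P)) ->
  0 <= min_cost p w S.
Proof.
move=> p0 Sw.
have cost0 (t : 'S_(size S)) : 0 <= perm_cost p w t.
  rewrite -(ler_int R) /perm_cost rmorph_sum /=.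
  pose W a := w (lattice_pt R (tnth (in_tuple S) a)).
  have W0 a : 0 <= W a by apply: Sw; exact: mem_tnth.
  apply: (@le_trans _ _ (\sum_a (p%:R * W (t a) - W a))); last first.
    apply: ler_sum => a _; apply: le_trans (ceil_ge _).
    by rewrite linearB linearZ.
  rewrite sumrB subr_ge0 -mulr_sumr [X in _ <= _ * X](_ : _ = \sum_a W a).
    by rewrite ler_peMl ?sumr_ge0 // ler1n.
  by rewrite [RHS](reindex_perm t).
by rewrite /min_cost; apply: le_bigmin.
Qed.

Lemma padic_char0 (p : nat) (p_pr : prime p) k : (k.+1%:R : padic p_pr) != 0.
Proof. by rewrite -(rmorph_nat (@tofrac _)) tofrac_eq0 padic_nat_neq0. Qed.

Section NewtonPoints.
Variables (R : realType) (p : nat) (p_pr : prime p).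
Variables (K : closedFieldType) (iota : {rmorphism 'F_p -> K}).
Variables (f : mpoly 2 K) (P1 P2 : R^o * R^o).
Hypothesis f_hull : newton_polytope R f = convex_hull [set (0, 0); P1; P2].
Variables (n : nat) (n_card : (coeff_field f #= `I_(p ^ n))%card).
Variable L : forall k : nat, unramified_ext p_pr K ((p ^ n) ^ k.+1).
Variable w : {scalar (R^o * R^o)%type}.
Hypothesis w_line : forall t : R, w ((1 - t) *: P1 + t *: P2) = 1.

Lemma coeff_field_fixed : (0 < n)%N /\ forall m, mcoeff m f ^+ (p ^ n) = mcoeff m f.
Proof.
have A1 : coeff_field f 1 by move=> B [[B1 _ _] _]; exact/set_mem.
have AB x y : coeff_field f x -> coeff_field f y -> coeff_field f (x - y).
  move=> Ax Ay B [[B1 BB BD] gB]; apply/set_mem/BB; apply/mem_set.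
    by apply: Ax; split.
  by apply: Ay; split.
have AD x y : coeff_field f x -> coeff_field f y -> coeff_field f (x / y).
  move=> Ax Ay B [[B1 BB BD] gB]; apply/set_mem/BD; apply/mem_set.
    by apply: Ax; split.
  by apply: Ay; split.
have A0 : coeff_field f 0 by rewrite -(subrr 1); apply: AB.
have AM x y : coeff_field f x -> coeff_field f y -> coeff_field f (x * y).
  by move=> Ax Ay; rewrite -[y]invrK -[y^-1]mul1r; apply: (AD) => //; apply: (AD).
have [q1 fixed] := finite_field_fixed A0 A1 AM n_card; split.
  by case: (n) q1.
by move=> m; apply: fixed => B [_ gB]; apply: gB; exists m.
Qed.

(** Precision N = j + 1 suffices to see the coefficient of T^j.  By
[series_compare] this coefficient is one of det(1 - s Z) for the block-cyclic
matrix Z, and a nonzero term of Leibniz' formula provides both the multiset and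
a permutation of cost at most j. *)
Lemma newton_point i j : fcoef (fcoef (char_series L f) i) j != 0 ->
  exists S : {mset int * int}%mset, [/\ size S = (n * i)%N,
    forall P, P \in S -> cone_lattice (newton_polytope R f) P,
    forall P, (S P <= n)%N & min_cost p w S <= j%:Z].
Proof.
have [n0 f_fixed] := coeff_field_fixed.
have DQ k : ((p ^ n) ^ k.+1 = p ^ (n * k.+1))%N by rewrite expnM.
have r0 k : (0 < n * k.+1)%N by rewrite muln_gt0 n0.
have /choice[g g_prim] := fun k => prim_root_closed p_pr iota (r0 k) (DQ k).
have fixed_pow k (x : K) : x ^+ (p ^ n) = x -> x ^+ ((p ^ n) ^ k) = x.
  by move=> xq; elim: k => [|k IHk]; rewrite ?expr1 // expnSr exprM IHk.
have f_fixedk k m : mcoeff m f ^+ ((p ^ n) ^ k.+1) = mcoeff m f by apply: fixed_pow.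
have f_fixed1 m : mcoeff m f ^+ ((p ^ n) ^ 1) = mcoeff m f by apply: fixed_pow.
have sub k (x : K) : x ^+ ((p ^ n) ^ 1) = x -> x ^+ ((p ^ n) ^ k.+1) = x.
  by rewrite expn1; apply: fixed_pow.
have /all_sig[phi phiP] := fun k => cid (teich_embedding iota (r0 0%N) (DQ 0%N) (g_prim 0%N)
  (L 0%N) (L k) (r0 k) (DQ k) (g_prim k) (sub k)).
have L0_char k : (k.+1%:R : L 0%N) != 0 by apply: ur_natr_neq0.
(* The threshold c is the least one allowed by weight_overflow. *)
pose N := j.+1; pose c : R := N%:R / (p%:R - 1).
have p1 : 0 < (p%:R - 1 : R) by rewrite subr_gt0 ltr1n prime_gt1.
have c_large : N%:R <= (p%:R - 1) * c by rewrite /c mulrCA divff ?mulr1 // gt_eqF.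
have c_ge0 : 0 <= c by rewrite divr_ge0 // ltW.
have [X [X_uniq XP]] := cone_bounded w_line c.
set cone := cone_lattice _ in XP *; pose wt : {additive (int * int)%type -> R} := @lattice_wt R w.
have f_supp m : m \in msupp f -> cone (exponent m) /\ wt (exponent m) <= 1.
  move=> fm; apply: (triangle_lattice w_line); rewrite -f_hull.
  by apply: convex_hull_sub; right; exists m => //=; rewrite -mcoeff_msupp.
pose F := splitting (L 0%N) f N; pose Mx := trans_mx p F X.
have F_fil i' : filtered cone wt 1 (F i').
  apply: (filtered_series (cone_0 _ _) (@cone_add R P1 P2)); first exact: binom_coef_small.
  by move=> u /mapP[m fm ->]; exact: f_supp.
have tr_sum k := @exp_sum_trace p p_pr K iota _ (r0 k) _ (DQ k) _ (g_prim k) (L k) f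
  (f_fixedk k) R cone wt N c X (cone_0 _ _) (@cone_add R P1 P2) (@cone_divn R P1 P2)
  f_supp X_uniq XP c_large c_ge0.
pose T r := \tr (\prod_(i < r) Mx i).
pose t k : fps (L 0%N) := if k is k'.+1 then map_fps (in_alg (L 0%N))
  (((((p ^ n) ^ k)%:R - 1) ^- 2 : padic p_pr) *: exp_sum (L k') f) else 0.
(* The trace formula holds over L k; it is pulled back to L 0 along phi k. *)
have T_t k : eqT N (T (n * k.+1)%N) (t k.+1).
  move=> l lN; have [phi_sc phi_t] := phiP k.
  have MxE i' : trans_mx p (splitting (L k) f N) X i' = map_mx (map_fps (phi k)) (Mx i').
    by apply: trans_mx_map => i''; apply: splitting_map => m; apply: phi_t.
  have := tr_sum k l lN; rewrite (trace_prod_map _ MxE) fcoef_natM => e_l.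
  apply: (fmorph_inj (phi k)).
  rewrite -[fcoef (t k.+1) l]/(((((p ^ n) ^ k.+1)%:R - 1) ^- 2 * fcoef (exp_sum (L k) f) l)%:A) phi_sc.
  set q := ((p ^ n) ^ k.+1)%N in e_l *.
  have -> : (q%:R - 1 : padic p_pr) = q.-1%:R.
    by rewrite -subn1 natrB // expn_gt0 expn_gt0 prime_gt0.
  rewrite -[RHS]/(in_alg (L k) _) rmorphM /= -[_%:A * _]/(in_alg (L k) _ * _) fmorphV rmorphXn rmorph_nat /=.
  rewrite -[(fcoef _ l)%:A]/(fcoef (map_fps (in_alg (L k)) (exp_sum (L k) f)) l) e_l.
  rewrite natrX mulKf // expf_neq0 // ur_natr_neq0 //.
  exact: prim_order_gt0 (g_prim k).
pose cc k := map_fps (in_alg (L 0%N)) (fcoef (char_series L f) k).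
have cc0 : cc 0%N = 1.
  by rewrite /cc /char_series fps_exp0 rmorph1.
have ccS k : k.+1%:R * cc k.+1 = - \sum_(a < k.+1) t a.+1 * cc (k - a)%N.
  rewrite /cc /char_series; set gg := Fps _.
  have := @fps_expS (padic p_pr) (fps (padic p_pr)) (padic_char0 p_pr) gg k erefl.
  move: (fps_exp gg) => CC /(congr1 (map_fps (in_alg (L 0%N)))).
  rewrite rmorphM rmorph_nat rmorph_sum => ->; rewrite -sumrN.
  apply: eq_bigr => a _; rewrite rmorphM -mulNr; congr (_ * _).
  rewrite -[t a.+1]/(map_fps (in_alg (L 0%N)) _) -rmorphN; congr (map_fps _ _).
  rewrite mulr_natl -scaler_nat /= scalerA mulrN mulrCA divff ?padic_char0 // mulr1.
  by rewrite scaleNr.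
have Mx_per k : Mx (k + n) = Mx k.
  rewrite /Mx /trans_mx; suff -> : F (k + n)%N = F k by [].
  suff tt_per : teich_terms (L 0%N) f (k + n) = teich_terms (L 0%N) f k.
    by rewrite /F /splitting tt_per.
  apply: eq_map => m; congr (_, _%:A).
  have [_ _] := teichP iota (r0 0%N) (DQ 0%N) (g_prim 0%N) (L 0%N) (f_fixed1 m).
  have -> : (p ^ (k + n) = (p ^ n) ^ 1 * p ^ k)%N by rewrite expn1 addnC expnD.
  by rewrite exprM => ->.
pose Z := cyclic_mx n Mx.
have trZ r : (0 < r)%N -> eqT N (\tr (Z ^+ r))
       (if (n %| r)%N then n%:R * t (r %/ n)%N else 0).
  move=> r_gt0; rewrite (trace_cyclic_mx Mx_per); case: ifP => // nr.
  apply: eqTM => //; case Dr : (r %/ n)%N => [|k].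
    by have := divnK nr; rewrite Dr mul0n => Dr'; rewrite -Dr' in r_gt0.
  by rewrite -[in X in eqT _ X _](divnK nr) Dr mulnC; apply: T_t.
move=> nz.
have nzZ : fcoef (char_det Z)`_(n * i) j != 0.
  rewrite (series_compare L0_char n0 trZ cc0 ccS i (ltnSn j)) /cc /=.
  by rewrite -[_%:A]/(in_alg (L 0%N) _) fmorph_eq0.
pose pos (x : 'I_#|{: 'I_n * 'I_(size X)}|) : int * int :=
  X`_(enum_val x : 'I_n * 'I_(size X)).2.
pose cost (A B : int * int) := Num.ceil (w (p%:R *: lattice_pt R A - lattice_pt R B)).
have Z_cost x y k : fcoef (Z x y) k != 0 -> cost (pos y) (pos x) <= k%:Z.
  rewrite mxE /=; case: ifP => _; last by rewrite eqxx.
  rewrite mxE => /(filtered_coef (F_fil _)) [_].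
  by rewrite mul1r /cost /wt raddfB raddfMn /= ceil_le_int linearB linearZ /= mulr_natl.
have [s [J [szJ s_fix J_cost]]] := char_det_coef_neq0 Z_cost nzZ.
have [S [szS S_pos S_mult [tt S_cost]]] := mset_of_perm_support pos cost s_fix.
exists S; split.
- by rewrite szS szJ.
- move=> P /S_pos[x <-]; rewrite f_hull; apply: (proj1 (proj1 (XP _) _)).
  by rewrite mem_nth.
- move=> P; apply: leq_trans (S_mult P) _.
  rewrite -[X in (_ <= X)%N]card_ord -(card_in_imset (f := fun x => (enum_val x : 'I_n * 'I_(size X)).1)).
    exact: max_card.
  move=> x y; rewrite !inE => /eqP xP /eqP yP.
  case Dx : (enum_val x : 'I_n * 'I_(size X)) => [a b].
  case Dy : (enum_val y : 'I_n * 'I_(size X)) => [a' b'] /= aa'.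
  apply: enum_val_inj; rewrite Dx Dy aa'; congr pair; apply/ord_inj/eqP.
  by rewrite -(nth_uniq 0 _ _ X_uniq) //; move: xP yP; rewrite /pos Dx Dy /= => -> ->.
- apply: (le_trans (@min_cost_le R p w S tt)).
  by rewrite /perm_cost S_cost.
Qed.

End NewtonPoints.

Theorem proposition2p22 (R : realType)
    (p : nat) (p_pr : prime p) (p_odd : odd p)
    (* K is an algebraic closure of F_p *)
    (K : closedFieldType) (iota : {rmorphism 'F_p -> K})
    (K_alg : integralRange iota)
    (f : mpoly 2 K) (P1 P2 : R^o * R^o)
    (f_hull : newton_polytope R f = convex_hull [set (0, 0); P1; P2])
    (P_indep : P1.1 * P2.2 - P1.2 * P2.1 != 0)
    (n : nat) (n_card : (coeff_field f #= `I_(p ^ n))%card)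
    (L : forall k : nat, unramified_ext p_pr K ((p ^ n) ^ k.+1))
    (w : {scalar (R^o * R^o)%type})
    (w_line : forall t : R, w ((1 - t) *: P1 + t *: P2) = 1) (x : R) :
  (ihp p n (newton_polytope R f) w x <= np_T n (char_series L f) x)%E.
Proof.
apply: lower_hull_le => i r; set u := fcoef _ i; set I := ereal_inf _ => val_u.
have [n_gt0 _] := coeff_field_fixed n_card.
have ni_ge0 : 0 <= (n%:R^-1 : R) by rewrite invr_ge0.
have u_neq0 : exists j, fcoef u j != 0.
  apply: contrapT => /forallNP u0; move: val_u; rewrite /fps_val.
  have -> : [set j%:R%:E | j in [set j : nat | fcoef u j != 0]] = set0 :> set (\bar R).
    by apply/seteqP; split=> // _ [j /= uj _]; exact: u0 uj.
  by rewrite ereal_inf0 gt0_muley // lte_fin invr_gt0 ltr0n.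
case: (ex_minnP u_neq0) => j uj j_min.
have Dval : fps_val R u = j%:R%:E.
  apply/eqP; rewrite eq_le; apply/andP; split.
    by apply: ge_ereal_inf; exists j%:R%:E => //; exists j.
  by apply: le_ereal_inf_tmp => _ [k /= uk <-]; rewrite lee_fin ler_nat j_min.
have [S [szS S_cone S_mult S_cost]] := newton_point iota f_hull n_card w_line uj.
have I_le : (I <= j%:R%:E)%E.
  apply: ge_ereal_inf; exists ((min_cost p w S)%:~R%:E); first by exists S.
  by rewrite lee_fin -[j%:R]/(j%:Z%:~R) ler_int.
have I_ge0 : (0 <= I)%E.
  apply: le_ereal_inf_tmp => _ [S' [_ S'_cone _] <-].
  rewrite lee_fin ler0z; apply: min_cost_ge0; first exact: prime_gt0.
  move=> P /S'_cone; rewrite f_hull; exact: cone_wt_ge0 w_line _.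
have I_fin : (I \is a fin_num)%E.
  by rewrite ge0_fin_numE // (le_lt_trans I_le) // ltry.
move: val_u; rewrite Dval -EFinM => -[<-].
exists (n%:R^-1 * fine I); first by rewrite EFinM fineK.
by rewrite ler_wpM2l // -lee_fin fineK.
Qed.
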